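(* Let $n\geq1$ and $\sigma>0$. Suppose that for each $0<\alpha<1$ a symmetric Markov kernel $K^\sigma_\alpha$ on $\mathbb{R}^n$ is given with $K^\sigma_\alpha\in\mathcal{S}(\sigma,\alpha)$, and suppose that for some $0<\gamma<1$ the family $\mathcal{K}=\{K^\sigma_\alpha:0<\alpha<1\}$ satisfies $\mathcal{K}\subset\mathcal{H}\bigl(\gamma,\bigl(\tfrac{1+\gamma}{1-\gamma}\bigr)^{n+\sigma}\bigr)$. Then \begin{enumerate} \item[(a)] $\mathcal{K}$ has the concentration property: for every $\lambda>0$, $\int_{|x-z|\geq\lambda}K^\sigma_\alpha(x,z)\,dz\to0$ as $\alpha\to0$, uniformly in $x\in\mathbb{R}^n$; \item[(b)] the maximal operator $\mathcal{K}^*f(x)=\sup_{0<\alpha<1}\left|\int_{\mathbb{R}^n}K^\sigma_\alpha(x,z)f(z)\,dz\right|$ is of weak type $(1,1)$ and bounded on $L^p(\mathbb{R}^n)$ for $1<p\leq\infty$; \item[(c)] for every $f\in L^p(\mathbb{R}^n)$, $1\leq p\leq\infty$, $\lim_{\alpha\to0}\int_{\mathbb{R}^n}K^\sigma_\alpha(x,z)f(z)\,dz=f(x)$ for almost every $x$. \end{enumerate}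
   Context: A symmetric Markov kernel on $\mathbb{R}^n$ is a nonnegative measurable function $K$ on $\mathbb{R}^n\times\mathbb{R}^n$ with $K(x,z)=K(z,x)$ and $\int_{\mathbb{R}^n}K(x,z)\,dz=1$ for every $x$. For $0<\gamma<1$ and $H\geq1$, $K\in\mathcal{H}(\gamma,H)$ means that for every $x\in\mathbb{R}^n$ and every $\xi\in\mathbb{R}^n$ with $\xi\neq x$, $\sup_{z\in B(\xi,\gamma|x-\xi|)}K(x,z)\leq H\inf_{z\in B(\xi,\gamma|x-\xi|)}K(x,z)$. For $\sigma,\alpha>0$, $K\in\mathcal{S}(\sigma,\alpha)$ means $\lim_{|x-z|\to\infty}|x-z|^{n+\sigma}K(x,z)=\alpha$. *)

(* Defs.v *)
From HB Require Import structures.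
From mathcomp Require Import all_boot all_order all_algebra.
From mathcomp Require Import all_classical all_reals all_analysis measurable_realfun.
Set Implicit Arguments. Unset Strict Implicit. Unset Printing Implicit Defensive.
Import Order.TTheory GRing.Theory Num.Theory.
Import numFieldNormedType.Exports.
Local Open Scope classical_set_scope.
Local Open Scope ring_scope.

(* R^n, as row vectors, equipped with the Borel sigma-algebra
   (generated by the open sets of the product topology = Euclidean topology). *)
Definition Rn (R : realType) (n : nat) := g_sigma_algebraType (@open 'rV[R]_n).

Definition eudist (R : realType) (n : nat) (x z : 'rV[R]_n) : R :=
  Num.sqrt (\sum_(i < n) (x ord0 i - z ord0 i) ^+ 2).

Definition eball (R : realType) (n : nat) (xi : 'rV[R]_n) (r : R) : set (Rn R n) :=
  [set z : Rn R n | eudist z xi < r].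

Definition box (R : realType) (n : nat) (a b : 'rV[R]_n) : set (Rn R n) :=
  [set x : Rn R n | forall i, a ord0 i <= (x : 'rV[R]_n) ord0 i < b ord0 i].

(* mu is Lebesgue measure on the Borel sets of R^n: it gives every box its
   volume (this determines the measure uniquely). *)
Definition is_lebesgue (R : realType) (n : nat) (mu : {measure set (Rn R n) -> \bar R}) :=
  forall a b : 'rV[R]_n, (forall i, a ord0 i <= b ord0 i) ->
    mu (box a b) = (\prod_(i < n) (b ord0 i - a ord0 i))%:E.

Definition sym_markov_kernel (R : realType) (n : nat)
    (mu : {measure set (Rn R n) -> \bar R}) (K : Rn R n -> Rn R n -> R) :=
  [/\ measurable_fun setT (fun p : (Rn R n * Rn R n)%type => K p.1 p.2),
      (forall x z, 0 <= K x z),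
      (forall x z, K x z = K z x) &
      (forall x, (\int[mu]_z (K x z)%:E = 1)%E)].

Definition classH (R : realType) (n : nat) (gamma H : R) (K : Rn R n -> Rn R n -> R) :=
  forall (x xi : Rn R n), xi <> x ->
    (ereal_sup [set (K x z)%:E | z in eball xi (gamma * eudist x xi)]
     <= H%:E * ereal_inf [set (K x z)%:E | z in eball xi (gamma * eudist x xi)])%E.

Definition classS (R : realType) (n : nat) (sigma alpha : R) (K : Rn R n -> Rn R n -> R) :=
  forall e : R, 0 < e -> exists M : R, forall x z : Rn R n,
    M <= eudist x z -> `| eudist x z `^ (n%:R + sigma) * K x z - alpha | < e.

Definition inLp (R : realType) (n : nat) (mu : {measure set (Rn R n) -> \bar R})
    (p : \bar R) (f : Rn R n -> R) :=
  measurable_fun setT f /\ (Lnorm mu p (EFin \o f) < +oo)%E.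

Definition Kop (R : realType) (n : nat) (mu : {measure set (Rn R n) -> \bar R})
    (K : Rn R n -> Rn R n -> R) (f : Rn R n -> R) (x : Rn R n) : \bar R :=
  (\int[mu]_z (K x z * f z)%:E)%E.

Definition Kstar (R : realType) (n : nat) (mu : {measure set (Rn R n) -> \bar R})
    (K : R -> Rn R n -> Rn R n -> R) (f : Rn R n -> R) (x : Rn R n) : \bar R :=
  ereal_sup [set `| Kop mu (K alpha) f x |%E | alpha in `]0, 1[ ].

(* Main.v *)
Require Import Defs.
From HB Require Import structures.
From mathcomp Require Import all_boot all_order all_algebra.
From mathcomp Require Import all_classical all_reals all_analysis measurable_realfun ess_sup_inf.
From mathcomp Require Import ring lra.
Set Implicit Arguments. Unset Strict Implicit. Unset Printing Implicit Defensive.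
Import Order.TTheory GRing.Theory Num.Def Num.Theory.
Import numFieldNormedType.Exports.
Local Open Scope classical_set_scope.
Local Open Scope ring_scope.

(** Iterating the Harnack inequality along the ray from x through z, up to the
    region where the S(sigma, alpha) asymptotics are in force, gives
    K_alpha(x, z) <= C alpha |x - z|^-(n + sigma): the exponent of the Harnack
    constant is exactly the one that makes the losses cancel.  The concentration
    property follows, comparing the tail of |x - z|^-(n + sigma) with K_(1/2).
    Moreover Harnack bounds K(x, z) by its average over a cube around z of size
    comparable to |x - z|; by Tonelli, the averaging moves onto f and, K(x, .)
    having mass 1, the maximal operator is dominated by that of
    Hardy-Littlewood, uniformly in alpha.  Finally, almost everywhere convergence
    passes to limits in mean by weak type (1,1); concentration gives it at points
    near which f is constant, hence for finite unions of cubes, then for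
    Borel sets (Dynkin), simple functions and L^1.  Bounded functions are treated
    locally, and L^p is contained in L^1 + L^oo. *)

(** * Cubes in R^n *)

(** The decay bound is of no help near x, where |x - z|^-(n + sigma) is not integrable; it serves
    only the concentration property. The maximal operator is controlled without any information at z
    = x: the averaging cubes have radius proportional to |x - z| and never reach x, and the mass of
    K(x, .) is all that is used of its size. Two questions of measure theory shape the statements.
    The supremum over uncountably many alpha is not known to be measurable, so its superlevel sets
    and its norms are estimated through measurable majorants. And the exceptional set in (c) must
    not depend on alpha: convergence is expressed as a condition at a single point x, and only
    countably many null sets are discarded, one for each test function and each tolerance. Since
    [is_lebesgue] gives the volumes of boxes only, the geometry is that of the sup norm; the
    Euclidean distance enters through the two kernel classes and costs a factor sqrt n. *)

Lemma exprn_unbounded (R : realType) (q M : R) : 1 < q -> exists m, M <= q ^+ m.+1.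
Proof.
move=> q1; have bern m : 1 + m%:R * (q - 1) <= q ^+ m.
  elim: m => [|m ih]; first by rewrite mul0r addr0 expr0.
  rewrite exprS -natr1; apply: (@le_trans _ _ (q * (1 + m%:R * (q - 1)))); last first.
    by rewrite ler_pM2l//; lra.
  have : 0 <= m%:R * (q - 1) ^+ 2 by rewrite mulr_ge0// sqr_ge0.
  rewrite expr2; lra.
exists (Num.truncn (`|M| / (q - 1))); apply: le_trans (bern _).
have := truncnS_gt (`|M| / (q - 1)); rewrite ltr_pdivrMr; last lra.
by have := ler_norm M; lra.
Qed.

Definition cube {R : realType} {n : nat} (c : 'rV[R]_n) (r : R) : set (Rn R n) :=
  [set x : Rn R n | `|c - x : 'rV[R]_n| < r].

Section geometry.
Context {R : realType} {n : nat}.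
Implicit Types (c x y z : 'rV[R]_n) (r : R).

Lemma cube_ball c r : cube c r = ball c r :> set 'rV[R]_n.
Proof. by rewrite mx_norm_ball. Qed.

Lemma cubeP c r x : 0 < r ->
  cube c r x <-> forall i, `|c ord0 i - x ord0 i| < r.
Proof.
move=> r0; rewrite -[cube c r x]/((cube c r : set 'rV[R]_n) x) cube_ball; split.
  by move=> [_ h] i; exact: h.
by move=> h; split => // i j; rewrite ord1; exact: h.
Qed.

Lemma open_measurable_Rn (A : set 'rV[R]_n) : open A ->
  measurable (A : set (Rn R n)).
Proof. by move=> oA; exact: sub_sigma_algebra. Qed.

Lemma open_cube c r : open (cube c r : set 'rV[R]_n).
Proof.
have [r0|r0] := ltP 0 r; first by rewrite cube_ball; exact: ball_open.
rewrite (_ : cube c r = set0); first exact: open0.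
by apply/seteqP; split => // x; rewrite /cube/= ltNge (le_trans r0).
Qed.

Lemma measurable_cube c r : measurable (cube c r).
Proof. by apply: open_measurable_Rn; exact: open_cube. Qed.

Lemma continuous_measurable_Rn (f : 'rV[R]_n -> R) : continuous f ->
  measurable_fun setT (f : Rn R n -> R).
Proof.
move=> /continuousP cf; apply: (measurability _ (RGenOpens.measurableE R)) => //.
move=> _ [_ [a [b ->] <-]]; rewrite setTI; apply: open_measurable_Rn.
by apply: cf; exact: interval_open.
Qed.

Lemma measurable_coord i :
  measurable_fun setT (fun x : Rn R n => (x : 'rV[R]_n) ord0 i).
Proof.
by apply: (@continuous_measurable_Rn (fun x => x ord0 i)); exact: coord_continuous.
Qed.

Lemma coord_le_norm x i : `|x ord0 i| <= `|x|.
Proof.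
rewrite {2}/normr/= mx_normrE.
by apply: (@le_bigmax _ _ _ 0 (fun ij : 'I_1 * 'I_n => `|x ij.1 ij.2|) (ord0, i)).
Qed.

Lemma norm_le_coord x r : 0 <= r -> (forall i, `|x ord0 i| <= r) -> `|x| <= r.
Proof.
move=> r0 h; rewrite /normr/= mx_normrE; apply: bigmax_le => // -[i j] _ /=.
by rewrite ord1.
Qed.

(** Going through coordinates avoids identifying the product sigma-algebra on pairs with the Borel
    one, which an argument by continuity would call for. In the uses, [f] and [g] are projections,
    identities or constants. *)
Lemma measurable_dist d (T : measurableType d) (f g : T -> Rn R n) :
  measurable_fun setT f -> measurable_fun setT g ->
  measurable_fun setT (fun p => `|(f p : 'rV[R]_n) - (g p : 'rV[R]_n)|).
Proof.
move=> mf mg; rewrite (_ : (fun _ => _) =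
    (fun p => \big[maxr/0]_(ij : 'I_1 * 'I_n)
      `|(f p : 'rV[R]_n) ord0 ij.2 - (g p : 'rV[R]_n) ord0 ij.2|)).
  elim: (index_enum _) => [|[i j] s ih].
    by under eq_fun do rewrite big_nil; exact: measurable_cst.
  under eq_fun do rewrite big_cons; apply: measurable_maxr => //=.
  apply: measurableT_comp => //; apply: measurable_funB.
    exact: measurableT_comp (measurable_coord j) mf.
  exact: measurableT_comp (measurable_coord j) mg.
apply/funext => p; rewrite {1}/normr/= mx_normrE.
by apply: eq_bigr => -[i j] _; rewrite !mxE/= ord1.
Qed.

Lemma norm_le_eudist x y : `|x - y| <= eudist x y.
Proof.
apply: norm_le_coord => [|i]; first exact: sqrtr_ge0.
rewrite /eudist -sqrtr_sqr !mxE; apply: ler_wsqrtr.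
by rewrite (bigD1 i)//= lerDl sumr_ge0// => j _; exact: sqr_ge0.
Qed.

Lemma eudist_le_norm x y : eudist x y <= Num.sqrt n%:R * `|x - y|.
Proof.
rewrite -[X in _ * X]ger0_norm// -sqrtr_sqr -sqrtrM// /eudist; apply: ler_wsqrtr.
rewrite mulr_natl -[X in _ *+ X](card_ord n) -sumr_const ler_sum// => i _.
rewrite -[leLHS]real_normK ?num_real// lerXn2r ?nnegrE//.
by have := coord_le_norm (x - y) i; rewrite !mxE.
Qed.

Lemma eudistC x y : eudist x y = eudist y x.
Proof. by congr Num.sqrt; apply: eq_bigr => i _; rewrite -sqrrN opprB. Qed.

Lemma eudist_gt0 x y : (0 < eudist x y) = (x != y).
Proof.
apply/idP/idP => [|xy].
  apply: contraTneq => ->; rewrite -leNgt /eudist big1 ?sqrtr0// => i _.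
  by rewrite subrr expr0n.
by rewrite (lt_le_trans _ (norm_le_eudist _ _))// normr_gt0 subr_eq0.
Qed.

Lemma eudist_line x y (a b : R) :
  eudist (x + a *: (y - x)) (x + b *: (y - x)) = `|a - b| * eudist x y.
Proof.
rewrite /eudist -(sqrtr_sqr (a - b)) -sqrtrM ?sqr_ge0//.
congr Num.sqrt; rewrite big_distrr/=; apply: eq_bigr => i _.
by rewrite !mxE; ring.
Qed.

Lemma measurable_eudist d (T : measurableType d) (f g : T -> Rn R n) :
  measurable_fun setT f -> measurable_fun setT g ->
  measurable_fun setT (fun p => eudist (f p) (g p)).
Proof.
move=> mf mg; apply: (measurableT_comp (f := @Num.sqrt R)).
  by apply: continuous_measurable_fun; exact: sqrt_continuous.
apply: measurable_sum => i; apply: measurable_funX; apply: measurable_funB.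
  exact: measurableT_comp (measurable_coord i) mf.
exact: measurableT_comp (measurable_coord i) mg.
Qed.

End geometry.

(** * Volumes of cubes, null spheres, sigma-finiteness *)

Section lebesgue_cubes.
Context {R : realType} {n : nat} (mu : {measure set (Rn R n) -> \bar R}).
Hypothesis leb : is_lebesgue mu.
Implicit Types (c x : 'rV[R]_n) (r : R).

Definition sbox c r := box (c - const_mx r) (c + const_mx r).

Lemma sboxP c r x :
  sbox c r x <-> forall i, c ord0 i - r <= x ord0 i < c ord0 i + r.
Proof. by split=> h i; have := h i; rewrite !mxE. Qed.

Lemma measurable_sbox c r : measurable (sbox c r).
Proof.
rewrite (_ : sbox c r = \bigcap_(i in [set: 'I_n])
    ((fun x : Rn R n => (x : 'rV[R]_n) ord0 i) @^-1` `[c ord0 i - r, c ord0 i + r[)).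
  apply: fin_bigcap_measurable => // i _; rewrite -[_ @^-1` _]setTI.
  by apply: measurable_coord.
apply/seteqP; split => [x /sboxP h i _/=|x h].
  by rewrite in_itv/= h.
by apply/sboxP => i; have := h i I; rewrite /= in_itv.
Qed.

Lemma mu_sbox c r : 0 <= r -> mu (sbox c r) = ((2 * r) ^+ n)%:E.
Proof.
move=> r0; rewrite leb => [|i]; last by rewrite !mxE; lra.
congr EFin; rewrite (eq_bigr (fun=> 2 * r)) ?prodr_const ?card_ord// => i _.
by rewrite !mxE; ring.
Qed.

Lemma cube_sub_sbox c r : cube c r `<=` sbox c r.
Proof.
move=> x cx; apply/sboxP => i.
have := le_lt_trans (coord_le_norm (c - x) i) cx.
by rewrite !mxE ltr_norml => /andP[? ?]; apply/andP; split; lra.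
Qed.

Lemma mu_cube_le c r : 0 <= r -> (mu (cube c r) <= ((2 * r) ^+ n)%:E)%E.
Proof.
move=> r0; rewrite -(mu_sbox c r0); apply: le_measure; rewrite ?inE.
- exact: measurable_cube.
- exact: measurable_sbox.
- exact: cube_sub_sbox.
Qed.

Lemma mu_cube_lty c r : (mu (cube c r) < +oo)%E.
Proof.
have [r0|r0] := leP 0 r; first by rewrite (le_lt_trans (mu_cube_le c r0))// ltry.
rewrite (_ : cube c r = set0) ?measure0//.
by apply/seteqP; split => // x; rewrite /cube/= ltNge (le_trans (ltW r0)).
Qed.

(** The half-open cube of half the radius sits inside the open one. The factor 2^n lost against the
    exact volume only affects constants. *)
Lemma mu_cube_ge c r : 0 < r -> ((r ^+ n)%:E <= mu (cube c r))%E.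
Proof.
move=> r0; have -> : r = 2 * (r / 2) by field.
rewrite -(mu_sbox c); last by rewrite divr_ge0// ltW.
apply: le_measure; rewrite ?inE.
- exact: measurable_sbox.
- exact: measurable_cube.
- move=> x /sboxP h; have -> : 2 * (r / 2) = r by field.
  apply/cubeP => // i; have /andP[? ?] := h i.
  by rewrite ltr_norml; apply/andP; split; lra.
Qed.

Lemma measurable_sphere c r :
  measurable ([set x | `|c - x| = r] : set (Rn R n)).
Proof.
rewrite (_ : [set x | _] = (fun x : Rn R n => `|c - x : 'rV[R]_n|) @^-1` [set r])//.
rewrite -[_ @^-1` _]setTI.
apply: (@measurable_dist R n _ _ (cst c) id) => //; exact: measurable_set1.
Qed.

(** For r > 0 the sphere and the half-open cube of radius r - t are disjoint and both lie in the
    half-open cube of radius r + t, so the sphere weighs at most a difference of volumes that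
    vanishes with t. For r = 0 it is a point, which is null only because n > 0. *)
Lemma mu_sphere c r : (0 < n)%N -> mu ([set x | `|c - x| = r] : set (Rn R n)) = 0%E.
Proof.
move=> n0; set S := [set x | _].
have mS : measurable (S : set (Rn R n)) by exact: measurable_sphere.
apply/eqP; rewrite eq_le measure_ge0 andbT; apply/lee_addgt0Pr => e e0.
rewrite add0e.
have [r0|r0|r0] := ltgtP r 0.
- rewrite (_ : S = set0) ?measure0 ?lee_fin ?ltW//.
  by apply/seteqP; split => // x /= cx; have := normr_ge0 (c - x); rewrite cx leNgt r0.
- have cvg0 : (fun t : R => (2 * (r + t)) ^+ n - (2 * (r - t)) ^+ n) @ 0 --> (0 : R).
    suff : (fun t : R => (2 * (r + t)) ^+ n - (2 * (r - t)) ^+ n) @ (0 : R) -->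
        (2 * (r + 0)) ^+ n - (2 * (r - 0)) ^+ n by rewrite subr0 addr0 subrr.
    have cX (f : R -> R) (l : R) : f @ (0 : R) --> l ->
        (fun t => f t ^+ n) @ (0 : R) --> l ^+ n.
      by move=> fl; have := @cvg_comp _ _ _ f (fun y => y ^+ n) _ _ _ fl (@exprn_continuous R n l).
    apply: cvgB; [apply: (cX (fun t => 2 * (r + t)))|apply: (cX (fun t => 2 * (r - t)))];
      (apply: cvgM; first exact: cvg_cst).
      by apply: cvgD; [exact: cvg_cst|exact: cvg_id].
    by apply: cvgB; [exact: cvg_cst|exact: cvg_id].
  move/cvgrPdist_lt : cvg0 => /(_ _ e0)/nbhs_ballP[d /= d0 hd].
  pose t := minr (d / 2) (r / 2).
  have t0 : 0 < t by rewrite lt_min !divr_gt0.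
  have tr : t < r by rewrite gt_min orbC ltr_pdivrMr// ltr_pMr// ltr1n.
  have td : t < d by rewrite gt_min ltr_pdivrMr// ltr_pMr// ltr1n.
  have {hd}hd : (2 * (r + t)) ^+ n - (2 * (r - t)) ^+ n <= e.
    apply: ltW; apply: le_lt_trans (ler_norm _) _.
    have := hd t; rewrite sub0r normrN; apply.
    by rewrite /ball/= sub0r normrN gtr0_norm.
  have : (mu (S `|` sbox c (r - t)) <= ((2 * (r + t)) ^+ n)%:E)%E.
    rewrite -(mu_sbox c); last lra.
    apply: le_measure; rewrite ?inE.
    + by apply: measurableU => //; exact: measurable_sbox.
    + exact: measurable_sbox.
    + move=> x [Sx|/sboxP h]; apply/sboxP => i; last first.
        by have /andP[? ?] := h i; apply/andP; split; lra.
      have := coord_le_norm (c - x) i; rewrite !mxE Sx ler_norml => /andP[? ?].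
      by apply/andP; split; lra.
  have -> : mu (S `|` sbox c (r - t)) = (mu S + mu (sbox c (r - t)))%E.
    apply: measureU => //; first exact: measurable_sbox.
    apply/seteqP; split => // x [/= Sx /sboxP h].
    suff : `|c - x| <= r - t by rewrite Sx; lra.
    apply: norm_le_coord => [|i]; first lra.
    by have /andP[? ?] := h i; rewrite !mxE ler_norml; apply/andP; split; lra.
  rewrite mu_sbox; last lra.
  by rewrite -leeBrDr// -EFinB => /le_trans; apply; rewrite lee_fin.
(* With [2 * t <= 1] and n > 0, [(2 * t) ^+ n <= 2 * t <= e]. *)
- pose t := minr (e / 2) (1 / 2).
  have t0 : 0 < t by rewrite lt_min !divr_gt0.
  have : (mu (S : set (Rn R n)) <= ((2 * t) ^+ n)%:E)%E.
    apply: le_trans (mu_cube_le c (ltW t0)).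
    apply: le_measure; rewrite ?inE => //; first exact: measurable_cube.
    by move=> x /= Sx; rewrite /cube/= Sx r0.
  move/le_trans; apply; rewrite lee_fin.
  have t1 : 2 * t <= 1 by rewrite -ler_pdivlMl// mulrC ge_min lexx orbT.
  apply: (@le_trans _ _ (2 * t)).
    by rewrite -[leRHS]expr1 ler_wiXn2l//; lra.
  by rewrite -ler_pdivlMl// mulrC ge_min lexx.
Qed.

Lemma mu_point x : (0 < n)%N -> mu [set (x : Rn R n)] = 0%E.
Proof.
move=> n0; rewrite -(mu_sphere x 0 n0); congr (mu _); apply/seteqP; split => y /=.
  by move=> ->; rewrite subrr normr0.
by move/normr0_eq0/eqP; rewrite subr_eq0 => /eqP.
Qed.

Lemma measurable_point x : measurable [set (x : Rn R n)].
Proof.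
rewrite (_ : [set _] = [set y | `|x - y| = 0]); first exact: measurable_sphere.
apply/seteqP; split => y /=; first by move=> ->; rewrite subrr normr0.
by move/normr0_eq0/eqP; rewrite subr_eq0 => /eqP.
Qed.

Lemma bigcup_cube c : \bigcup_k cube c k.+1%:R = setT.
Proof.
apply/seteqP; split => // x _; exists (Num.truncn `|c - x|) => //.
by rewrite /cube/= truncnS_gt.
Qed.

Lemma lebesgue_sigma_finite : sigma_finite setT mu.
Proof.
exists (fun k => cube 0 k.+1%:R); first by rewrite bigcup_cube.
by move=> k; split; [exact: measurable_cube|exact: mu_cube_lty].
Qed.

End lebesgue_cubes.

(** * The Hardy-Littlewood maximal function *)

Section vitali.
Context {R : realType} {n : nat} {I : eqType} (c : I -> 'rV[R]_n) (r : I -> R).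
Let B i := cube (c i) (r i).

Lemma cube_sub3 i j : r i <= r j -> B i `&` B j !=set0 ->
  B i `<=` cube (c j) (3 * r j).
Proof.
move=> ij [y [iy jy]] x ix; rewrite /cube/=.
have -> : c j - x = (c j - y) + (c i - x) - (c i - y).
  by apply/rowP => k; rewrite !mxE; ring.
rewrite /B /cube/= in iy jy ix.
apply: le_lt_trans (ler_normB _ _) _; rewrite -ltrBrDr.
apply: le_lt_trans (ler_normD _ _) _; lra.
Qed.

(** Greedy selection, larger cubes first: the list is sorted by increasing radius, so the head is
    examined after its tail. If it meets a selected cube, that cube is at least as large and its
    triple covers the head; otherwise the head is selected too. *)
Lemma vitali_cubes (s : seq I) :
  exists D : seq I, [/\ uniq D, {subset D <= s}, trivIset [set` D] B &
    forall i, i \in s -> exists2 j, j \in D & B i `<=` cube (c j) (3 * r j)].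
Proof.
pose LE i j := r i <= r j.
have LE_trans : transitive LE by move=> x y z; exact: le_trans.
wlog : s / sorted LE s.
  have : sorted LE (sort LE s) by apply: sort_sorted => x y; exact: le_total.
  move=> /[swap] /[apply] -[D [uD Ds tD H]]; exists D; split => //.
  - by move=> x /Ds; rewrite mem_sort.
  - by move=> i; rewrite -(mem_sort LE) => /H.
elim: s => [_|i s ih /= is_s].
  by exists [::]; split => // k l /=; rewrite inE.
have [D [uD Ds tD H]] := ih (path_sorted is_s).
have le_i j : j \in s -> r i <= r j by have /allP := order_path_min LE_trans is_s; apply.
have [[j [jD ij]]|K] := pselect (exists j, j \in D /\ B i `&` B j !=set0).
  exists D; split => //; first by move=> k /Ds ks; rewrite inE ks orbT.
  move=> k /[1!inE] /predU1P[->|/H//]; exists j => //.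
  exact: cube_sub3 (le_i _ (Ds _ jD)) ij.
(* The list may have repetitions. An [i] already selected that meets no selected cube, itself
   included, has an empty cube. *)
have [iD|iD] := boolP (i \in D).
  exists D; split => //; first by move=> k /Ds ks; rewrite inE ks orbT.
  move=> k /[1!inE] /predU1P[->|/H//]; exists i => // x ix.
  by exfalso; apply: K; exists i; split => //; exists x.
exists (i :: D); split.
- by rewrite /= iD.
- by move=> k /[1!inE] /predU1P[->|/Ds ks]; rewrite inE ?eqxx ?ks ?orbT.
- move=> k l /= /[1!inE] /predU1P[->{k}|kD] /[1!inE] /predU1P[->{l}|lD] //.
  + by move=> il; exfalso; apply: K; exists l.
  + by rewrite setIC => il; exfalso; apply: K; exists k.
  + exact: tD.
- move=> k /[1!inE] /predU1P[->|/H[j jD kj]]; last by exists j => //; rewrite inE jD orbT.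
  exists i; first by rewrite inE eqxx.
  by move=> x ix; apply: (@cube_sub3 i i (lexx _) _ x ix); exists x.
Qed.

End vitali.

Lemma measure_bigsetU_seq_le d (T : measurableType d) (R : realType)
    (mu : {measure set T -> \bar R}) (I : eqType) (s : seq I) (F : I -> set T) :
  (forall i, measurable (F i)) ->
  (mu (\big[setU/set0]_(i <- s) F i) <= \sum_(i <- s) mu (F i))%E.
Proof.
move=> mF; elim: s => [|i s ih]; first by rewrite !big_nil measure0.
rewrite !big_cons; apply: le_trans (measureU2 _ _ _) _ => //.
  exact: bigsetU_measurable.
exact: leeD2l.
Qed.

Section countable_unions.
Context {J : countType} {T : Type} (A : set J) (F : J -> set T).

(** The elements of [A] with code below k. These lists grow with k and exhaust [A], which turns a
    countable union into an increasing limit of finite unions, the only ones that the covering lemma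
    handles. *)
Definition enum_seq k : seq J := [seq j <- pmap unpickle (iota 0 k) | `[< A j >]].

Lemma mem_enum_seq k j : j \in enum_seq k -> A j.
Proof. by rewrite mem_filter => /andP[/asboolP]. Qed.

Lemma bigsetU_enum_seqP k x : (\big[setU/set0]_(j <- enum_seq k) F j) x <->
  exists2 j, j \in enum_seq k & F j x.
Proof. by rewrite -bigcup_seq; split => -[j js jx]; exists j. Qed.

Lemma bigcup_enum_seq :
  \bigcup_k \big[setU/set0]_(j <- enum_seq k) F j = \bigcup_(j in A) F j.
Proof.
apply/seteqP; split => [x [k _ /bigsetU_enum_seqP[j js jx]]|x [j Aj jx]].
  by exists j => //; exact: mem_enum_seq js.
exists (pickle j).+1 => //; apply/bigsetU_enum_seqP; exists j => //.
rewrite mem_filter; apply/andP; split; first exact/asboolP.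
by rewrite mem_pmap; apply/mapP; exists (pickle j); rewrite ?pickleK// mem_iota/=.
Qed.

Lemma nondecreasing_enum_seq : {homo (fun k => \big[setU/set0]_(j <- enum_seq k) F j)
  : k l / (k <= l)%N >-> (k <= l)%O}.
Proof.
move=> k l kl; rewrite subsetEset => x /bigsetU_enum_seqP[j js jx].
apply/bigsetU_enum_seqP; exists j => //.
move: js; rewrite !mem_filter => /andP[-> /=]; rewrite !mem_pmap.
move=> /mapP[i]; rewrite mem_iota/= add0n => ik ->; apply/mapP; exists i => //.
by rewrite mem_iota add0n/= (leq_trans ik).
Qed.

End countable_unions.

Section maximal_function.
Context {R : realType} {n : nat} (mu : {measure set (Rn R n) -> \bar R}).
Hypothesis leb : is_lebesgue mu.
Implicit Types (F : Rn R n -> \bar R) (x : 'rV[R]_n).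

Let J := ('rV[rat]_n * rat)%type.
Definition qcenter (j : J) : 'rV[R]_n := map_mx ratr j.1.
Definition qradius (j : J) : R := ratr j.2.
Definition qcube (j : J) := cube (qcenter j) (qradius j).

(** Normalised by the volume of the surrounding half-open box rather than by [mu (qcube j)], so that
    the upper bound [mu_cube_le] suffices to compare the two. *)
Definition qavg F (j : J) : \bar R :=
  (((2 * qradius j) ^+ n)^-1%:E * \int[mu]_(y in qcube j) F y)%E.

(* Averages run over a countable family of cubes, so measurability is free. *)
Definition HLmax F (x : Rn R n) : \bar R :=
  ereal_sup [set qavg F j | j in [set j | 0 < qradius j /\ qcube j x]].

(** This rests on the uncentred form of the maximal function: a cube whose average exceeds t lies
    entirely in the superlevel set. *)
Lemma HLmax_superlevel F (t : \bar R) :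
  [set x | (t < HLmax F x)%E] =
  \bigcup_(j in [set j | 0 < qradius j /\ (t < qavg F j)%E]) qcube j.
Proof.
apply/seteqP; split => [x /= /ereal_sup_gtP[_ [j [r0 jx] <-] tj]|x [j [r0 tj] jx]].
  by exists j.
by apply/ereal_sup_gtP; exists (qavg F j) => //; exists j.
Qed.

Lemma measurable_HLmax_superlevel F t : measurable [set x | (t < HLmax F x)%E].
Proof.
rewrite HLmax_superlevel bigcup_mkcond.
apply: countable_bigcupT_measurable => [|j]; first exact: countableP.
by case: ifP => // _; exact: measurable_cube.
Qed.

Lemma measurable_HLmax F : measurable_fun setT (HLmax F).
Proof.
apply: (measurability _ (ErealGenOInfty.measurableE R)) => // _ [_ [a ->] <-].
rewrite setTI (_ : _ @^-1` _ = [set x | (a%:E < HLmax F x)%E]).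
  exact: measurable_HLmax_superlevel.
by apply/seteqP; split => x /=; rewrite in_itv/= andbT.
Qed.

Lemma ratr_row_approx x (e : R) : 0 < e ->
  exists q : 'rV[rat]_n, `|x - map_mx ratr q| < e.
Proof.
move=> e0; have e20 : 0 < e / 2 by rewrite divr_gt0.
have /choice[q hq] (i : 'I_n) : exists q : rat, `|x ord0 i - ratr q| <= e / 2.
  have [q] := @rat_in_itvoo R (x ord0 i - e / 2) (x ord0 i + e / 2) ltac:(lra).
  rewrite in_itv/= => /andP[? ?]; exists q.
  by rewrite ler_norml; apply/andP; split; lra.
exists (\row_i q i); apply: (@le_lt_trans _ _ (e / 2)); last lra.
by apply: norm_le_coord => [|i]; [lra|rewrite !mxE].
Qed.

Lemma integral_cube_le_HLmax F x (r : R) : measurable_fun setT F ->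
  (forall y, 0 <= F y)%E -> 0 < r ->
  (\int[mu]_(y in cube x r) F y <= ((6 * r) ^+ n)%:E * HLmax F x)%E.
Proof.
move=> mF F0 r0.
have [q qx] := ratr_row_approx x r0.
(* With a centre within r of x, a radius above 2r makes the rational cube contain [cube x r]; a
   radius below 3r keeps its nominal volume under (6r)^n. *)
have [s] := @rat_in_itvoo R (2 * r) (3 * r) ltac:(lra).
rewrite in_itv/= => /andP[s2 s3].
pose j : J := (q, s).
have j0 : 0 < qradius j by rewrite /qradius/=; lra.
have jx : qcube j x by rewrite /qcube /cube/= /qcenter distrC/= /qradius/=; lra.
have xj : cube x r `<=` qcube j.
  move=> y; rewrite /qcube /cube/= => xy; rewrite /qcenter/= -(subrKA x) /qradius/=.
  by apply: le_lt_trans (ler_normD _ _) _; rewrite distrC; lra.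
have : (qavg F j <= HLmax F x)%E by apply: ereal_sup_ubound; exists j.
rewrite /qavg muleC lee_pdivrMr; last by rewrite exprn_gt0//; lra.
move=> h; apply: (@le_trans _ _ (\int[mu]_(y in qcube j) F y)%E).
  apply: ge0_subset_integral => //; [exact: measurable_cube|exact: measurable_cube|].
  exact: measurable_funTS.
apply: le_trans h _; rewrite muleC lee_wpmul2r//.
  apply: (@le_trans _ _ (qavg F j)); last by apply: ereal_sup_ubound; exists j.
  rewrite /qavg mule_ge0 ?integral_ge0// lee_fin invr_ge0 exprn_ge0//; lra.
by rewrite lee_fin lerXn2r ?nnegrE//; rewrite ?/qradius/=; lra.
Qed.

Lemma HLmax_ge0 F x : (forall y, 0 <= F y)%E -> (0 <= HLmax F x)%E.
Proof.
move=> F0; have [q qx] := ratr_row_approx x (@ltr01 R).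
pose j : J := (q, 1).
have j1 : qradius j = 1 by rewrite /qradius rmorph1.
apply: (@le_trans _ _ (qavg F j)); last first.
  apply: ereal_sup_ubound; exists j => //; split; first by rewrite j1.
  by rewrite /qcube /cube/= j1 /qcenter distrC.
by rewrite /qavg mule_ge0 ?integral_ge0// lee_fin invr_ge0 exprn_ge0// j1.
Qed.

(** Finitely many cubes at a time: Vitali selects disjoint ones whose triples cover the union,
    whence 3^n; each has nominal volume at most 1 / t times its integral, and disjointness adds the
    integrals up. Continuity of [mu] from below then reaches the whole superlevel set. *)
Lemma HLmax_weak F (t : R) : measurable_fun setT F -> (forall y, 0 <= F y)%E ->
  0 < t ->
  (mu [set x | (t%:E < HLmax F x)%E] <= (3 ^+ n / t)%:E * \int[mu]_y F y)%E.
Proof.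
move=> mF F0 t0; rewrite HLmax_superlevel.
set A := [set j | _].
pose s k := enum_seq A k.
pose U k := \big[setU/set0]_(j <- s k) qcube j.
have mU k : measurable (U k) by apply: bigsetU_measurable => j _; exact: measurable_cube.
have UA : \bigcup_k U k = \bigcup_(j in A) qcube j by exact: bigcup_enum_seq.
have ndU : {homo U : k l / (k <= l)%N >-> (k <= l)%O} by exact: nondecreasing_enum_seq.
have mUA : measurable (\bigcup_k U k) by exact: bigcupT_measurable.
have cvgU := nondecreasing_cvg_mu (mu := mu) mU mUA ndU.
rewrite -UA -(cvg_lim _ cvgU)//; apply: lime_le; first by apply/cvg_ex; eexists; exact: cvgU.
apply: nearW => k /=.
have [D [uD Ds tD H]] := vitali_cubes qcenter qradius (s k).
apply: (@le_trans _ _ (mu (\big[setU/set0]_(j <- D) cube (qcenter j) (3 * qradius j)))).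
  apply: le_measure; rewrite ?inE//.
    by apply: bigsetU_measurable => j _; exact: measurable_cube.
  move=> x /bigsetU_enum_seqP[i /H[j jD ij] ix]; rewrite -bigcup_seq; exists j => //; exact: ij.
apply: le_trans (measure_bigsetU_seq_le _ _ _) _; first by move=> j; exact: measurable_cube.
apply: (@le_trans _ _ (\sum_(j <- D) (3 ^+ n / t)%:E * \int[mu]_(y in qcube j) F y)%E).
  rewrite big_seq [leRHS]big_seq; apply: lee_sum => j jD.
  have [r0 tj] := mem_enum_seq (Ds _ jD).
  apply: le_trans (mu_cube_le leb _ _) _; first lra.
  move: tj; rewrite /qavg => /ltW; rewrite lee_pdivlMl; last by rewrite exprn_gt0//; lra.
  move=> tj; rewrite EFinM -muleA.
  have -> : ((2 * (3 * qradius j)) ^+ n)%:E = ((3 ^+ n)%:E * ((2 * qradius j) ^+ n)%:E)%E.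
    by rewrite -EFinM -exprMn; congr (EFin (_ ^+ _)); ring.
  apply: lee_wpmul2l; first by rewrite lee_fin exprn_ge0.
  by rewrite lee_pdivlMl// muleC.
rewrite -ge0_sume_distrr; last by move=> j _; exact: integral_ge0.
apply: lee_wpmul2l; first by rewrite lee_fin divr_ge0// ?exprn_ge0// ltW.
rewrite -ge0_integral_bigsetU//.
- apply: ge0_subset_integral => //.
  by apply: bigsetU_measurable => j _; exact: measurable_cube.
- by move=> j; exact: measurable_cube.
- exact: measurable_funTS.
Qed.

(** The values of F below t / 2 add at most t / 2 to any average, so a cube with average above t
    keeps one above t / 2 after F is truncated. This combines the weak (1,1) bound with the trivial
    L^oo bound, and is the hypothesis of the interpolation below. *)
Lemma HLmax_weak_trunc F (t : R) : measurable_fun setT F -> (forall y, 0 <= F y)%E ->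
  0 < t ->
  (mu [set x | (t%:E < HLmax F x)%E] <=
   (2 * 3 ^+ n / t)%:E * \int[mu]_(y in [set y | ((t / 2)%:E < F y)%E]) F y)%E.
Proof.
move=> mF F0 t0; set E := [set y | ((t / 2)%:E < F y)%E].
have mE : measurable E.
  have := @measurable_lte _ _ R _ measurableT (cst (t / 2)%:E) F.
  by rewrite setTI => /(_ (measurable_cst _) mF).
have mFE : measurable_fun setT (F \_ E).
  by apply/(measurable_restrictT _ _).1 => //; exact: measurable_funTS.
have FE0 y : (0 <= (F \_ E) y)%E by apply: erestrict_ge0.
have t20 : 0 < t / 2 by rewrite divr_gt0.
have cst0 : (0 <= (t / 2)%:E)%E by rewrite lee_fin ltW.
have -> : 2 * 3 ^+ n / t = 3 ^+ n / (t / 2) by field; rewrite gt_eqF.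
rewrite [X in (_ <= _ * X)%E]integral_mkcond.
apply: le_trans (HLmax_weak mFE FE0 t20); apply: le_measure; rewrite ?inE.
- exact: measurable_HLmax_superlevel.
- exact: measurable_HLmax_superlevel.
rewrite !HLmax_superlevel => x [j [r0 tj] jx]; exists j => //; split => //.
have v0 : 0 < (2 * qradius j) ^+ n by rewrite exprn_gt0//; lra.
have mj : measurable (qcube j) by exact: measurable_cube.
rewrite ltNge; apply/negP; rewrite /qavg muleC lee_pdivrMr// => le_t.
move: tj; rewrite ltNge => /negP; apply; rewrite /qavg muleC lee_pdivrMr//.
apply: (@le_trans _ _ (\int[mu]_(y in qcube j) ((F \_ E) y + (t / 2)%:E))%E).
  apply: ge0_le_integral => //.
  - exact: measurable_funTS.
  - by apply: emeasurable_funD => //; exact: measurable_funTS.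
  - move=> y _; rewrite /patch; case: ifPn => [_|/negP yE]; first by rewrite leeDl.
    by rewrite add0e leNgt; apply/negP => h; apply: yE; rewrite inE.
rewrite ge0_integralD//; last by apply: measurable_funTS.
have -> : (\int[mu]_(y in qcube j) (t / 2)%:E = (t / 2)%:E * mu (qcube j))%E.
  by rewrite -integral_cst.
have -> : (t%:E * ((2 * qradius j) ^+ n)%:E =
    (t / 2)%:E * ((2 * qradius j) ^+ n)%:E + (t / 2)%:E * ((2 * qradius j) ^+ n)%:E)%E.
  by rewrite -!EFinM -EFinD; congr EFin; field.
apply: leeD => //; apply: lee_wpmul2l; first by rewrite lee_fin ltW.
by apply: mu_cube_le; rewrite // ltW.
Qed.

End maximal_function.

(** * Marcinkiewicz interpolation on dyadic levels *)

Section marcinkiewicz.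
Context d (T : measurableType d) (R : realType) (mu : {measure set T -> \bar R}).
Context (M : T -> \bar R) (g : T -> R) (B p : R).
Hypothesis mM : measurable_fun setT M.
Hypothesis M_ge0 : forall x, (0 <= M x)%E.
Hypothesis mg : measurable_fun setT g.
Hypothesis g_ge0 : forall x, 0 <= g x.
Hypothesis B_ge0 : 0 <= B.
Hypothesis p_gt1 : 1 < p.
Hypothesis weak : forall t : R, 0 < t ->
  (mu [set x | (t%:E < M x)%E] <=
   (B / t)%:E * \int[mu]_(y in [set y | ((t / 2)%:E < (g y)%:E)%E]) (g y)%:E)%E.

Let p_gt0 : 0 < p. Proof. exact: lt_trans p_gt1. Qed.

Let p1_gt0 : 0 < p - 1. Proof. by rewrite subr_gt0. Qed.

(** Dyadic levels replace the layer-cake integral over t by a series, which can be exchanged with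
    the integral termwise. Starting from a base level tau > 0 leaves only k >= 0; tau tends to 0 at
    the end. *)
Let lev (tau : R) k := 2 ^+ k * tau.

Let lev_gt0 tau k : 0 < tau -> 0 < lev tau k.
Proof. by move=> t0; rewrite mulr_gt0// exprn_gt0. Qed.

Let dyadic_level (tau t : R) : 0 < tau -> tau < t ->
  exists k, lev tau k < t <= lev tau k.+1.
Proof.
move=> tau0 taut.
have ex : exists k, t <= lev tau k.+1.
  have [k hk] := @exprn_unbounded R 2 (t / tau) ltac:(lra).
  by exists k; rewrite /lev -ler_pdivrMr.
case: (ex_minnP ex) => k tk kmin; exists k; rewrite tk andbT.
case: k tk kmin => [_ _|k _ kmin]; first by rewrite /lev expr0 mul1r.
by rewrite ltNge; apply/negP => /kmin; rewrite ltnn.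
Qed.

Let E tau k := [set x | ((lev tau k)%:E < M x)%E].

Let mE tau k : measurable (E tau k).
Proof.
have := @measurable_lte _ _ R _ measurableT (cst (lev tau k)%:E) M.
by rewrite setTI => /(_ (measurable_cst _) mM).
Qed.

Let powM_le_dyadic (tau : R) x : 0 < tau -> (tau%:E < M x)%E ->
  (M x `^ p <= \sum_(k <oo) ((lev tau k.+1 `^ p)%:E * (\1_(E tau k) x)%:E))%E.
Proof.
move=> tau0 tauM; set S := (\sum_(k <oo) _)%E.
have p0 := p_gt0.
have term0 k : (0 <= (lev tau k.+1 `^ p)%:E * (\1_(E tau k) x)%:E)%E.
  by rewrite -EFinM lee_fin mulr_ge0// powR_ge0.
have termS k : E tau k x -> ((lev tau k.+1 `^ p)%:E <= S)%E.
  move=> Ek; rewrite /S (nneseriesD1 (n := k))// indicE mem_set// mule1.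
  by rewrite leeDl//; apply: nneseries_ge0.
have real_le (t : R) : tau < t -> (t%:E <= M x)%E -> ((t `^ p)%:E <= S)%E.
  move=> taut tM; have [k /andP[kt tk]] := dyadic_level tau0 taut.
  apply: le_trans (termS k _); last by rewrite /E/=; apply: lt_le_trans tM; rewrite lte_fin.
  by rewrite lee_fin ge0_ler_powR ?nnegrE// ltW// ?lev_gt0//; exact: lt_trans taut.
move: (M_ge0 x) tauM real_le; case: (M x) => [m||]// _ tauM real_le.
  by rewrite poweR_EFin; apply: real_le.
rewrite poweRyr ?gt_eqF// (_ : S = +oo%E)//; apply: eq_infty => r.
(* At an infinite value of M every level is exceeded. The 1 gives t <= t^p since p > 1, and
   [2 * tau] puts t strictly above the base level. *)
pose t := maxr r (maxr 1 (2 * tau)).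
have t1 : 1 <= t by rewrite !le_max lexx !orbT.
apply: (@le_trans _ _ (t `^ p)%:E).
  rewrite lee_fin (@le_trans _ _ t)//; first by rewrite le_max lexx.
  by rewrite le1r_powR// ltW.
apply: real_le; last by rewrite leey.
by rewrite !lt_max (_ : tau < 2 * tau) ?orbT//; lra.
Qed.

Let q := 2 `^ (p - 1).

Let q_gt1 : 1 < q.
Proof.
have -> : 1 = 1 `^ (p - 1) :> R by rewrite powR1.
by rewrite /q gt0_ltr_powR ?nnegrE// ltr1n.
Qed.

Let lev_powR tau k : 0 < tau -> lev tau k `^ (p - 1) = q ^+ k * tau `^ (p - 1).
Proof.
move=> t0; rewrite powRM ?exprn_ge0 ?ltW//; congr (_ * _).
by rewrite -powR_mulrn// -powRrM mulrC powRrM powR_mulrn// powR_ge0.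
Qed.

(** A geometric sum of ratio q > 1 is comparable to its last term, here the largest level below b.
    The ratio exceeds 1 precisely because p > 1. *)
Let geometric_dyadic (tau b : R) m : 0 < tau -> 0 <= b ->
  \sum_(k < m) lev tau k `^ (p - 1) * (lev tau k < b)%R%:R <=
  q / (q - 1) * b `^ (p - 1).
Proof.
move=> tau0 b0.
have q10 : 0 < q - 1 by have := q_gt1; lra.
elim: m => [|m ih].
  by rewrite big_ord0 mulr_ge0 ?powR_ge0// divr_ge0 ?powR_ge0// ltW.
rewrite big_ord_recr/=; case: ltP => levm; last by rewrite mulr0 addr0.
rewrite mulr1.
apply: (@le_trans _ _ (\sum_(k < m.+1) lev tau k `^ (p - 1))).
  rewrite big_ord_recr/= lerD2r; apply: ler_sum => k _.
  by rewrite ler_piMr ?powR_ge0//; case: (_ < _).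
apply: (@le_trans _ _ (q / (q - 1) * lev tau m `^ (p - 1))); last first.
  rewrite ler_wpM2l ?divr_ge0 ?powR_ge0//; first by rewrite ltW.
  by rewrite ge0_ler_powR ?nnegrE// ltW// lev_gt0.
rewrite lev_powR// (eq_bigr (fun k : 'I_m.+1 => q ^+ k * tau `^ (p - 1))); last first.
  by move=> k _; rewrite lev_powR.
rewrite -mulr_suml mulrA; apply: ler_wpM2r; first exact: powR_ge0.
rewrite mulrAC ler_pdivlMr// -exprS mulrC -subrX1.
by rewrite lerBlDr lerDl.
Qed.

(** B comes from the weak bound, 2^p from the upper end of a dyadic layer being twice the lower one,
    q / (q - 1) from the geometric sum, and 2^(p - 1) from truncating at half the level, which lets
    the sum run over levels up to 2 g(x). *)
Definition marcinkiewicz_const : R :=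
  B * 2 `^ p * (q / (q - 1)) * 2 `^ (p - 1).

Lemma marcinkiewicz_const_ge0 : 0 <= marcinkiewicz_const.
Proof.
have q10 : 0 < q - 1 by have := q_gt1; lra.
by rewrite /marcinkiewicz_const !mulr_ge0 ?powR_ge0// invr_ge0 ltW.
Qed.

Let G tau k := [set y | ((lev tau k / 2)%:E < (g y)%:E)%E].

Let mG tau k : measurable (G tau k).
Proof.
have := @measurable_lte _ _ R _ measurableT (cst (lev tau k / 2)%:E) (EFin \o g).
rewrite setTI => /(_ (measurable_cst _)); apply.
exact/measurable_EFinP.
Qed.

Let c tau k := lev tau k.+1 `^ p * (B / lev tau k).

Let c_ge0 tau k : 0 < tau -> 0 <= c tau k.
Proof. by move=> t0; rewrite mulr_ge0 ?powR_ge0// divr_ge0// ltW// lev_gt0. Qed.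

Let cE tau k : 0 < tau -> c tau k = B * 2 `^ p * lev tau k `^ (p - 1).
Proof.
move=> t0; have l0 := lev_gt0 k t0.
rewrite /c {1}/lev exprS -mulrA -/(lev tau k) powRM// ?ltW//.
rewrite -(@mulr_powRB1 R (lev tau k) p) ?ltW//.
by field; rewrite gt_eqF.
Qed.

Let dyadic_sum_le (tau : R) x : 0 < tau ->
  (\sum_(k <oo) ((c tau k)%:E * (((EFin \o g) \_ (G tau k)) x)) <=
   (marcinkiewicz_const * g x `^ p)%:E)%E.
Proof.
move=> tau0.
have term0 k : (0 <= (c tau k)%:E * (((EFin \o g) \_ (G tau k)) x))%E.
  rewrite mule_ge0//; first by rewrite lee_fin c_ge0.
  by rewrite erestrict_ge0// => y _; rewrite lee_fin.
apply: lime_le; first by apply: is_cvg_nneseries => k _ _.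
apply: nearW => m.
rewrite big_mkord (eq_bigr (fun k : 'I_m => (B * 2 `^ p * g x *
    (lev tau k `^ (p - 1) * (lev tau k < 2 * g x)%R%:R))%:E)); last first.
  move=> k _; rewrite patchE cE//.
  have -> : (x \in G tau k) = (lev tau k < 2 * g x).
    apply/idP/idP; first by rewrite inE /G/= lte_fin ltr_pdivrMr// mulrC.
    by move=> h; rewrite inE /G/= lte_fin ltr_pdivrMr// mulrC.
  case: (_ < _); last by rewrite mule0 !mulr0.
  by rewrite /= -EFinM; congr EFin; rewrite mulr1; ring.
rewrite sumEFin lee_fin -mulr_sumr.
have gx := g_ge0 x.
apply: (@le_trans _ _ (B * 2 `^ p * g x * (q / (q - 1) * (2 * g x) `^ (p - 1)))).
  rewrite ler_wpM2l ?mulr_ge0 ?powR_ge0//; apply: geometric_dyadic => //; lra.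
rewrite powRM// /marcinkiewicz_const -(@mulr_powRB1 R (g x) p)//.
by rewrite le_eqVlt; apply/orP; left; apply/eqP; ring.
Qed.

Let integral_superlevel (tau : R) : 0 < tau ->
  (\int[mu]_x ((fun x => M x `^ p) \_ (E tau 0)) x <=
   marcinkiewicz_const%:E * \int[mu]_x (g x `^ p)%:E)%E.
Proof.
move=> tau0.
have mMp : measurable_fun setT (fun x => M x `^ p)%E.
  exact: (measurableT_comp (measurable_poweR p)).
have mgG k : measurable_fun setT ((EFin \o g) \_ (G tau k)).
  by apply/(measurable_restrictT _ _).1 => //; apply: measurable_funTS; exact/measurable_EFinP.
have gG0 k x : (0 <= ((EFin \o g) \_ (G tau k)) x)%E.
  by rewrite erestrict_ge0// => y _; rewrite lee_fin.
have m1 k : measurable_fun setT (fun x => (lev tau k.+1 `^ p)%:E * (\1_(E tau k) x)%:E)%E.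
  by apply: measurable_funeM; apply/measurable_EFinP; exact: measurable_indic.
have t1 k x : (0 <= (lev tau k.+1 `^ p)%:E * (\1_(E tau k) x)%:E)%E.
  by rewrite -EFinM lee_fin mulr_ge0// powR_ge0.
have m2 k : measurable_fun setT (fun x => (c tau k)%:E * ((EFin \o g) \_ (G tau k)) x)%E.
  exact: measurable_funeM.
have t2 k x : (0 <= (c tau k)%:E * ((EFin \o g) \_ (G tau k)) x)%E.
  by rewrite mule_ge0// lee_fin c_ge0.
apply: (@le_trans _ _ (\int[mu]_x
    \sum_(k <oo) ((lev tau k.+1 `^ p)%:E * (\1_(E tau k) x)%:E))%E).
  apply: ge0_le_integral.
  - exact: measurableT.
  - by move=> x _; apply: erestrict_ge0 => y _; exact: poweR_ge0.
  - by apply/(measurable_restrictT _ _).1 => //; exact: measurable_funTS.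
  - exact: ge0_emeasurable_sum.
  move=> x _; rewrite patchE; case: ifPn => [|_]; last exact: nneseries_ge0.
  rewrite inE /E/= /lev expr0 mul1r => tauM; exact: powM_le_dyadic.
rewrite integral_nneseries//.
apply: (@le_trans _ _ (\sum_(k <oo)
    \int[mu]_x ((c tau k)%:E * ((EFin \o g) \_ (G tau k)) x))%E).
  apply: lee_nneseries => [k _ _|k _]; first exact: integral_ge0.
  rewrite ge0_integralZl//; last 2 first.
  - by apply/measurable_EFinP; exact: measurable_indic.
  - by rewrite lee_fin powR_ge0.
  rewrite integral_indic// setIT ge0_integralZl//; last by rewrite lee_fin c_ge0.
  rewrite -integral_mkcond /c EFinM -muleA; apply: lee_wpmul2l.
    by rewrite lee_fin powR_ge0.
  exact: weak (lev_gt0 k tau0).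
rewrite -integral_nneseries//.
rewrite -ge0_integralZl//; last 3 first.
- by apply/measurable_EFinP; exact: (measurableT_comp (measurable_powR p)).
- by move=> x _; rewrite lee_fin powR_ge0.
- by rewrite lee_fin marcinkiewicz_const_ge0.
apply: ge0_le_integral.
- exact: measurableT.
- by move=> x _; exact: nneseries_ge0.
- exact: ge0_emeasurable_sum.
- apply: measurable_funeM; apply/measurable_EFinP.
  exact: (measurableT_comp (measurable_powR p)).
- by move=> x _; rewrite -EFinM; exact: dyadic_sum_le.
Qed.

Lemma marcinkiewicz :
  (\int[mu]_x (M x `^ p) <= marcinkiewicz_const%:E * \int[mu]_x (g x `^ p)%:E)%E.
Proof.
have mMp : measurable_fun setT (fun x => M x `^ p)%E.
  exact: (measurableT_comp (measurable_poweR p)).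
(* The sets where M > 1 / (j + 1) increase to the set where M > 0, outside which the p-th power
   vanishes; monotone convergence removes the base level. *)
pose h j := (fun x => M x `^ p)%E \_ (E j.+1%:R^-1 0).
have mh j : measurable_fun setT (h j).
  by apply/(measurable_restrictT _ _).1 => //; exact: measurable_funTS.
have h0 j x : (0 <= h j x)%E by apply: erestrict_ge0 => y _; exact: poweR_ge0.
have ndh x : {homo h^~ x : i j / (i <= j)%N >-> (i <= j)%E}.
  move=> i j ij; rewrite /h !patchE; case: ifPn => [|_]; last first.
    by case: ifPn => // _; exact: poweR_ge0.
  rewrite inE /E/= => iM; rewrite mem_set//=; apply: le_lt_trans iM.
  by rewrite lee_fin /lev !expr0 !mul1r lef_pV2 ?posrE// ler_nat.
have cvgh := cvg_monotone_convergence (mu := mu) measurableT mh (fun j x _ => h0 j x) (fun x _ => ndh x).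
have limh : (fun x => limn (h^~ x)) = (fun x => M x `^ p)%E.
  apply/funext => x; apply/cvg_lim => //.
  have [M0|M0] := eqVneq (M x) 0%E.
    rewrite (_ : h^~ x = cst (M x `^ p)%E); first exact: cvg_cst.
    apply/funext => j; rewrite /h patchE memNset// /E/= ?M0 ?poweR0r ?gt_eqF//.
    by rewrite lte_fin; apply/negP; rewrite -leNgt ltW// lev_gt0.
  have {M0}M0 : (0 < M x)%E by rewrite lt0e M0 M_ge0.
  have [j0 hj0] : exists j, ((j.+1%:R^-1)%:E < M x)%E.
    move: M0; case: (M x) => [m||]//; last by exists 0%N; rewrite ltry.
    rewrite lte_fin => m0; exists (Num.truncn m^-1).
    by rewrite lte_fin invf_plt ?posrE// truncnS_gt.
  apply: cvg_near_cst; near=> j; rewrite /h patchE mem_set//= /E/=.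
  apply: le_lt_trans hj0; rewrite lee_fin /lev expr0 mul1r lef_pV2 ?posrE// ler_nat ltnS.
  by near: j; exists j0.
rewrite -limh -(cvg_lim _ cvgh)//; apply: lime_le; first by apply/cvg_ex; eexists; exact: cvgh.
by apply: nearW => j; apply: integral_superlevel; rewrite invr_gt0.
Unshelve. all: by end_near. Qed.

End marcinkiewicz.

(** * Harnack kernels *)

(** A copy of [mu] indexed by the proof that it is Lebesgue measure, to which the sigma-finite
    structure required by Tonelli can be attached. *)
Definition lebesgue_of {R : realType} {n : nat} {mu : {measure set (Rn R n) -> \bar R}}
  (leb : is_lebesgue mu) : set (Rn R n) -> \bar R := mu.
HB.instance Definition _ R n mu (leb : @is_lebesgue R n mu) :=
  Measure.copy (lebesgue_of leb) mu.
HB.instance Definition _ R n mu (leb : @is_lebesgue R n mu) :=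
  Measure_isSigmaFinite.Build _ _ _ (lebesgue_of leb) (lebesgue_sigma_finite leb).

Section harnack_average.
Context {R : realType} {n : nat} (mu : {measure set (Rn R n) -> \bar R}).
Hypothesis leb : is_lebesgue mu.
Hypothesis n_gt0 : (0 < n)%N.

Lemma lebesgue_fubini_tonelli (f : Rn R n * Rn R n -> \bar R) :
  measurable_fun setT f -> (forall p, 0 <= f p)%E ->
  (\int[mu]_w \int[mu]_z f (w, z) = \int[mu]_z \int[mu]_w f (w, z))%E.
Proof.
move=> mf f0.
exact: (@fubini_tonelli _ _ _ _ _ (lebesgue_of leb) (lebesgue_of leb)).
Qed.

(* Each value k z is dominated by H times the average of k over a cube around z
   whose size is comparable to |x - z|; exchanging integrals moves the average
   from k onto F. *)
Lemma integral_kernel_le_HLmax (x : 'rV[R]_n) (c H : R) (k : Rn R n -> R)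
    (F : Rn R n -> \bar R) :
  0 < c <= 1 / 2 -> 0 <= H ->
  measurable_fun setT k -> (forall z, 0 <= k z) -> (\int[mu]_z (k z)%:E = 1)%E ->
  (forall z w : 'rV[R]_n, `|z - w| < c * `|x - z| -> k z <= H * k w) ->
  measurable_fun setT F -> (forall z, 0 <= F z)%E ->
  (\int[mu]_z ((k z)%:E * F z) <= (H * (36 / c) ^+ n)%:E * HLmax mu F x)%E.
Proof.
move=> /andP[c0 c2] H0 mk k0 k1 hk mF F0.
pose D : set (Rn R n * Rn R n)%type :=
  [set p | `|(p.2 : 'rV[R]_n) - p.1| < c * `|x - p.2|].
(* Normalisation of the average over the cube around z of radius c|x - z|, but written in terms of w
   so that it leaves the z-integral after the exchange: c <= 1/2 gives |x - w| <= 2|x - z| on [D],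
   hence a(w) >= (c|x - z|)^-n. *)
pose a (w : Rn R n) := (2 / c) ^+ n * `|x - (w : 'rV[R]_n)| `^ (- n%:R).
have aE (w : 'rV[R]_n) : 0 < `|x - w| -> a w = (2 / (c * `|x - w|)) ^+ n.
  move=> xw0; rewrite /a powRN powR_mulrn// -exprVn -exprMn; congr (_ ^+ _).
  by field; rewrite !gt_eqF.
pose A (p : Rn R n * Rn R n) := k p.1 * a p.1 * \1_D p.
have a0 w : 0 <= a w by rewrite mulr_ge0 ?powR_ge0// exprn_ge0// divr_ge0// ltW.
have A0 p : 0 <= A p by apply: mulr_ge0 => //; exact: mulr_ge0.
have mdx : measurable_fun setT (fun w : Rn R n => `|x - (w : 'rV[R]_n)|).
  exact: (@measurable_dist R n _ _ (cst x) id).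
have mD : measurable D.
  have := @measurable_fun_ltr _ _ R setT
    (fun p : Rn R n * Rn R n => `|(p.2 : 'rV[R]_n) - p.1|)
    (fun p : Rn R n * Rn R n => c * `|x - (p.2 : 'rV[R]_n)|).
  move=> /(_ (measurable_dist measurable_snd measurable_fst)).
  have mdx2 : measurable_fun setT (fun p : Rn R n * Rn R n => c * `|x - (p.2 : 'rV[R]_n)|).
    apply: measurable_funM => //.
    exact: (measurableT_comp mdx measurable_snd).
  move=> /(_ mdx2 measurableT [set true] I); rewrite setTI.
  rewrite (_ : _ @^-1` _ = D)//.
have ma : measurable_fun setT a.
  apply: measurable_funM => //.
  exact: (measurableT_comp (measurable_powR (- n%:R))).
have mA : measurable_fun setT A.
  apply: measurable_funM; last exact: measurable_indic.
  by apply: measurable_funM; apply: measurableT_comp => //; exact: measurable_fst.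
have mG : measurable_fun setT (fun p => (A p)%:E * F p.2)%E.
  apply: emeasurable_funM; first exact/measurable_EFinP.
  exact: measurableT_comp measurable_snd.
have G0 p : (0 <= (A p)%:E * F p.2)%E by rewrite mule_ge0// lee_fin.
have mA1 z : measurable_fun setT (fun w => (A (w, z))%:E).
  by apply/measurable_EFinP; exact: (measurable_fun_pair1 z mA).
have mint1 : measurable_fun setT (fun w => \int[mu]_z ((A (w, z))%:E * F z))%E.
  exact: (@measurable_fun_fubini_tonelli_F _ _ _ _ _ (lebesgue_of leb) _ mG G0).
have mint2 : measurable_fun setT (fun z => \int[mu]_w ((A (w, z))%:E * F z))%E.
  exact: (@measurable_fun_fubini_tonelli_G _ _ _ _ _ (lebesgue_of leb) _ mG G0).
have M0 : (0 <= HLmax mu F x)%E by exact: HLmax_ge0.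
have step1 : (\int[mu]_z ((k z)%:E * F z) <=
    \int[mu]_z (H%:E * \int[mu]_w ((A (w, z))%:E * F z)))%E.
  apply: ae_ge0_le_integral => //.
  - by move=> z _; rewrite mule_ge0// lee_fin.
  - by apply: emeasurable_funM => //; exact/measurable_EFinP.
  - by move=> z _; rewrite mule_ge0// integral_ge0// => w _; exact: (G0 (w, z)).
  - exact: measurable_funeM.
  (* At z = x the averaging cube is empty and the comparison may fail; this single point is null. *)
  exists [set (x : Rn R n)]; split; [exact: measurable_point|exact: mu_point|].
  move=> z /= /not_implyP[_ hz]; apply: contrapT => zx; apply: hz.
  set s := `|x - z|; pose e := c * s.
  have s0 : 0 < s by rewrite normr_gt0 subr_eq0; apply/eqP => /esym.
  have e0 : 0 < e by rewrite mulr_gt0.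
  rewrite (@ge0_integralZr _ _ R mu setT measurableT (fun w => (A (w, z))%:E))//; last first.
    by move=> w _; rewrite lee_fin.
  rewrite muleA; apply: lee_wpmul2r => //.
  pose b := k z / e ^+ n.
  have b0 : 0 <= b by rewrite divr_ge0// exprn_ge0// ltW.
  apply: (@le_trans _ _ (\int[mu]_(w in cube z e) b%:E)%E).
    have -> : (\int[mu]_(w in cube z e) b%:E = b%:E * mu (cube z e))%E.
      by rewrite -integral_cst//; exact: measurable_cube.
    apply: (@le_trans _ _ (b%:E * (e ^+ n)%:E)%E).
      by rewrite -EFinM lee_fin /b divfK// gt_eqF// exprn_gt0.
    by apply: lee_wpmul2l => //; exact: mu_cube_ge.
  rewrite -(@ge0_integralZl _ _ R mu setT measurableT _ (mA1 z) H%:E)//; last first.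
    by move=> w _; rewrite lee_fin.
  apply: (@le_trans _ _ (\int[mu]_(w in cube z e) (H%:E * (A (w, z))%:E))%E).
    apply: ge0_le_integral => //.
    - exact: measurable_cube.
    - by apply: measurable_funTS; exact: measurable_funeM.
    move=> w zw; rewrite -EFinM lee_fin /A indicE mem_set//= mulr1 mulrA /b.
    have zw' : `|w - z| < e by rewrite distrC.
    have xw0 : 0 < `|x - w|.
      have := ler_normD (x - w) (w - z); rewrite subrKA -/s /e in zw' *.
      by nra.
    apply: ler_pM => //; first by rewrite invr_ge0 exprn_ge0// ltW.
      by apply: hk.
    rewrite aE// -exprVn; apply: lerXn2r; rewrite ?nnegrE.
    + by rewrite invr_ge0 ltW.
    + by rewrite divr_ge0// mulr_ge0// ltW.
    rewrite ler_pdivlMr ?mulr_gt0// mulrC ler_pdivrMr//.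
    have := ler_normB (x - z) (w - z); rewrite opprB subrKA -/s => xw.
    rewrite /e mulrCA ler_pM2l//; rewrite /e in zw'; nra.
  apply: ge0_subset_integral => //; first exact: measurable_cube.
    exact: measurable_funeM.
  by move=> w _; rewrite mule_ge0// lee_fin.
apply: le_trans step1 _; rewrite ge0_integralZl//; last first.
  by move=> z _; rewrite integral_ge0// => w _; exact: (G0 (w, z)).
rewrite EFinM -muleA; apply: lee_wpmul2l => //.
rewrite -(@lebesgue_fubini_tonelli (fun p => (A p)%:E * F p.2)%E)//=.
apply: (@le_trans _ _ (\int[mu]_w ((((36 / c) ^+ n)%:E * HLmax mu F x) * (k w)%:E))%E).
  apply: ge0_le_integral.
  - exact: measurableT.
  - by move=> w _; rewrite integral_ge0// => z _; exact: (G0 (w, z)).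
  - exact: mint1.
  - by apply: measurable_funeM; exact/measurable_EFinP.
  move=> w _; set p := `|x - (w : 'rV[R]_n)|.
  have [xw|p0] := eqVneq p 0.
    rewrite integral0_eq ?mule_ge0 ?lee_fin ?exprn_ge0 ?divr_ge0 ?(ltW c0)// => z _.
    rewrite /A indicE memNset/= ?mulr0 ?mul0e// /D/=.
    move/normr0_eq0/eqP: xw; rewrite subr_eq0 => /eqP <-; rewrite distrC.
    have := normr_ge0 (x - (z : 'rV[R]_n)); nra.
  have {}p0 : 0 < p by rewrite lt_neqAle eq_sym p0 normr_ge0.
  pose q := k w * a w.
  have q0 : 0 <= q by rewrite mulr_ge0.
  (* For fixed w, c <= 1/2 confines z to |x - z| < 2p, well within radius 3p. The integral of F
     there is at most (18 p)^n times the maximal function, and a(w) = (2 / (c p))^n turns this into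
     (36 / c)^n. *)
  apply: (@le_trans _ _ (\int[mu]_z (q%:E * (F \_ (cube x (3 * p))) z))%E).
    apply: ge0_le_integral.
    - exact: measurableT.
    - by move=> z _; exact: (G0 (w, z)).
    - exact: (measurable_fun_pair2 w mG).
    - apply: measurable_funeM; apply/(measurable_restrictT _ _).1.
        exact: measurable_cube.
      exact: measurable_funTS.
    move=> z _; rewrite /A indicE/= -/q.
    have [|_] := boolP ((w, z) \in D); last first.
      by rewrite mulr0 mul0e mule_ge0// ?lee_fin//; exact: erestrict_ge0.
    rewrite inE /D/= => zw; rewrite mulr1 patchE mem_set// /cube/=.
    have := ler_normD (x - w) (w - z); rewrite subrKA -/p [`|w - _|]distrC.
    move: zw; set u := `|z - _|; set v := `|x - _|; nra.
  rewrite ge0_integralZl//; last 2 first.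
  - apply/(measurable_restrictT _ _).1; first exact: measurable_cube.
    exact: measurable_funTS.
  - by move=> z _; exact: erestrict_ge0.
  rewrite -integral_mkcond.
  apply: (@le_trans _ _ (q%:E * (((6 * (3 * p)) ^+ n)%:E * HLmax mu F x))%E).
    apply: lee_wpmul2l => //; apply: integral_cube_le_HLmax => //; lra.
  rewrite muleA [leRHS]muleAC; apply: lee_wpmul2r => //.
  rewrite -!EFinM lee_fin /q aE// -/p -mulrA -exprMn [leLHS]mulrC.
  suff -> : 2 / (c * p) * (6 * (3 * p)) = 36 / c by [].
  by field; rewrite !gt_eqF.
rewrite ge0_integralZl//.
- by rewrite k1 mule1.
- exact/measurable_EFinP.
- by move=> w _; rewrite lee_fin.
- by rewrite mule_ge0// lee_fin exprn_ge0// divr_ge0// ltW.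
Qed.

End harnack_average.

(** The constant of [integral_kernel_le_HLmax] for c = gamma / (2 sqrt n): sqrt n passes from the
    sup norm to the Euclidean one, and the 2 ensures c <= 1/2. *)
Definition harnack_const {R : realType} (n : nat) (gamma H : R) : R :=
  H * (36 / (gamma / (2 * Num.sqrt n%:R))) ^+ n.

(** * Harnack chains, decay at infinity, concentration *)

Section kernels.
Context {R : realType} {n : nat} (mu : {measure set (Rn R n) -> \bar R}).
Hypothesis leb : is_lebesgue mu.
Hypothesis n_gt0 : (0 < n)%N.
Implicit Types (k : Rn R n -> Rn R n -> R) (x z w xi : 'rV[R]_n).

Lemma harnack_le k (gamma H : R) x xi z w : classH gamma H k -> 0 <= H -> xi <> x ->
  eudist z xi < gamma * eudist x xi -> eudist w xi < gamma * eudist x xi ->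
  k x z <= H * k x w.
Proof.
move=> hk H0 xix zxi wxi; rewrite -lee_fin EFinM.
apply: (@le_trans _ _ (ereal_sup
    [set (k x y)%:E | y in eball xi (gamma * eudist x xi)])).
  by apply: ereal_sup_ubound; exists z.
apply: le_trans (hk _ _ xix) _; apply: lee_wpmul2l => //.
by apply: ereal_inf_lbound; exists w.
Qed.

Lemma harnack_cube k (gamma H : R) x z w : classH gamma H k -> 0 <= H -> 0 < gamma ->
  `|z - w| < gamma / (2 * Num.sqrt n%:R) * `|x - z| -> k x z <= H * k x w.
Proof.
move=> hk H0 g0 zw.
have s0 : 0 < Num.sqrt n%:R :> R by rewrite sqrtr_gt0 ltr0n.
have s20 : 0 < gamma / (2 * Num.sqrt n%:R) by rewrite divr_gt0// mulr_gt0.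
have xz0 : 0 < `|x - z| by have := normr_ge0 (z - w); nra.
have xz : x != z by rewrite -subr_eq0 -normr_gt0.
have d0 : 0 < gamma * eudist x z by rewrite mulr_gt0// eudist_gt0.
apply: (@harnack_le k gamma H x z z w hk H0).
- by apply/eqP; rewrite eq_sym.
- by apply: le_lt_trans d0; rewrite leNgt eudist_gt0 eqxx.
- rewrite eudistC; apply: le_lt_trans (eudist_le_norm _ _) _.
  apply: (@lt_le_trans _ _ (gamma * `|x - z|)); last first.
    by rewrite ler_pM2l// norm_le_eudist.
  have : Num.sqrt n%:R * `|z - w| <
      Num.sqrt n%:R * (gamma / (2 * Num.sqrt n%:R) * `|x - z|) by rewrite ltr_pM2l.
  have -> : Num.sqrt n%:R * (gamma / (2 * Num.sqrt n%:R) * `|x - z|) =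
      gamma * `|x - z| / 2 by field; rewrite gt_eqF.
  have : 0 < gamma * `|x - z| by rewrite mulr_gt0.
  lra.
Qed.

Lemma measurable_kernel_section k x : measurable_fun setT (fun p : Rn R n * Rn R n => k p.1 p.2) ->
  measurable_fun setT (k x).
Proof. by move=> mk; exact: (measurable_fun_pair2 (x : Rn R n) mk). Qed.

Lemma harnack_const_ge0 (gamma H : R) : 0 <= gamma -> 0 <= H ->
  0 <= harnack_const n gamma H.
Proof.
move=> g0 H0; rewrite /harnack_const mulr_ge0// exprn_ge0// divr_ge0//.
by rewrite divr_ge0// mulr_ge0// sqrtr_ge0.
Qed.

Lemma integral_markov_le_HLmax k (gamma H : R) x (F : Rn R n -> \bar R) :
  sym_markov_kernel mu k -> classH gamma H k -> 0 <= H -> 0 < gamma < 1 ->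
  measurable_fun setT F -> (forall z, 0 <= F z)%E ->
  (\int[mu]_z ((k x z)%:E * F z) <= (harnack_const n gamma H)%:E * HLmax mu F x)%E.
Proof.
move=> [mk k0 _ k1] hk H0 /andP[g0 g1] mF F0.
have s1 : 1 <= Num.sqrt n%:R :> R.
  by rewrite -[leLHS]sqrtr1 ler_wsqrtr// ler1n.
apply: integral_kernel_le_HLmax => //.
- apply/andP; split; first by rewrite divr_gt0// mulr_gt0//; lra.
  by rewrite ler_pdivrMr; lra.
- exact: measurable_kernel_section.
- by move=> z w; exact: harnack_cube.
Qed.

Lemma abse_Kop_le k (f : Rn R n -> R) x : sym_markov_kernel mu k ->
  measurable_fun setT f ->
  (`|Kop mu k f x| <= \int[mu]_z ((k x z)%:E * `|f z|%:E))%E.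
Proof.
move=> [mk k0 _ _] mf; rewrite /Kop.
have mkf : measurable_fun setT (fun z : Rn R n => (k x z * f z)%:E).
  apply/measurable_EFinP; apply: measurable_funM => //.
  exact: measurable_kernel_section.
apply: le_trans (le_abse_integral mu measurableT mkf) _.
rewrite le_eqVlt; apply/orP; left; apply/eqP; apply: eq_integral => z _.
by rewrite abse_EFin normrM ger0_norm// EFinM.
Qed.

(** Take for xi the midpoint of the two points, at distance b = (1 + q) / 2 in units of |x - z|.
    Both are at distance (q - 1) / 2 from it, which is less than gamma * b exactly when q < (1 +
    gamma) / (1 - gamma). *)
Lemma harnack_ray k (gamma H q : R) x z : classH gamma H k -> 0 <= H -> 0 < gamma < 1 ->
  1 <= q < (1 + gamma) / (1 - gamma) -> z != x ->
  k x z <= H * k x (x + q *: (z - x)).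
Proof.
move=> hk H0 /andP[g0 g1] /andP[q1]; rewrite ltr_pdivlMr; last lra.
move=> qg zx; pose b := (1 + q) / 2.
have d0 : 0 < eudist x z by rewrite eudist_gt0 eq_sym.
have z1 : z = x + 1 *: (z - x) by apply/rowP => i; rewrite !mxE; ring.
have x1 : x = x + 0 *: (z - x) by apply/rowP => i; rewrite !mxE; ring.
have dxi : eudist x (x + b *: (z - x)) = b * eudist x z.
  by rewrite {1}x1 eudist_line sub0r normrN ger0_norm// /b; lra.
apply: (@harnack_le k gamma H x (x + b *: (z - x)) z _ hk H0).
- apply/eqP; rewrite eq_sym -eudist_gt0 dxi mulr_gt0// /b; lra.
- rewrite dxi {1}z1 eudist_line mulrA ltr_pM2r// ler0_norm /b; lra.
- rewrite dxi eudist_line mulrA ltr_pM2r// ger0_norm /b; lra.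
Qed.

Lemma harnack_ray_iter k (gamma H q : R) x z N : classH gamma H k -> 0 <= H ->
  0 < gamma < 1 -> 1 <= q < (1 + gamma) / (1 - gamma) -> z != x ->
  k x z <= H ^+ N * k x (x + q ^+ N *: (z - x)).
Proof.
move=> hk H0 g01 q1 zx; elim: N => [|N ih].
  by rewrite !expr0 mul1r (_ : _ + _ = z)//; apply/rowP => i; rewrite !mxE; ring.
apply: le_trans ih _; rewrite exprSr -mulrA ler_wpM2l ?exprn_ge0//.
have := @harnack_ray k gamma H q x (x + q ^+ N *: (z - x)) hk H0 g01 q1.
rewrite (_ : x + q *: (_ - x) = x + q ^+ N.+1 *: (z - x)); last first.
  by apply/rowP => i; rewrite !mxE exprS; ring.
apply; rewrite -subr_eq0 addrAC subrr add0r scaler_eq0 subr_eq0 (negbTE zx) orbF.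
by rewrite gt_eqF// exprn_gt0//; case/andP: q1 => ? _; lra.
Qed.

(* The step ratio q = rho^(m/(m+1)) < rho loses only a factor rho over all the
   m + 1 Harnack steps, whatever m is. *)
Lemma kernel_decay k (gamma sigma alpha : R) : 0 < gamma < 1 -> 0 < sigma -> 0 < alpha ->
  classS sigma alpha k ->
  classH gamma (((1 + gamma) / (1 - gamma)) `^ (n%:R + sigma)) k ->
  forall x z, z != x -> eudist x z `^ (n%:R + sigma) * k x z <=
    2 * ((1 + gamma) / (1 - gamma)) `^ (n%:R + sigma) * alpha.
Proof.
set rho := (1 + gamma) / (1 - gamma); set a := n%:R + sigma.
move=> g01 s0 al0 hS hH x z zx.
have rho1 : 1 < rho by rewrite ltr_pdivlMr; case/andP: g01 => ? ?; lra.
have a0 : 0 < a by rewrite ltr_wpDl.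
have H0 : 0 <= rho `^ a by exact: powR_ge0.
have d0 : 0 < eudist x z by rewrite eudist_gt0 eq_sym.
(* Tolerance alpha around the limit alpha gives the factor 2 of the bound. M depends on alpha, and m
   also on |x - z|, but neither survives in the estimate. *)
have [M hM] := hS alpha al0.
have [m Mm] := @exprn_unbounded R rho (M / eudist x z) rho1.
pose q := rho `^ (m.+1%:R / m.+2%:R).
have qm : q ^+ m.+2 = rho ^+ m.+1.
  rewrite -powR_mulrn ?powR_ge0// /q -powRrM divfK ?pnatr_eq0// powR_mulrn//; lra.
have q1 : 1 < q.
  have -> : 1 = 1 `^ (m.+1%:R / m.+2%:R) :> R by rewrite powR1.
  by rewrite gt0_ltr_powR// ?nnegrE ?divr_gt0//; lra.
have qrho : q < rho.
  rewrite -(@ltr_pXn2r _ m.+2) ?nnegrE//; [|lra|lra].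
  by rewrite qm [ltRHS]exprS ltr_pMl// exprn_gt0//; lra.
have q1rho : 1 <= q < rho by rewrite (ltW q1).
have := @harnack_ray_iter k gamma (rho `^ a) q x z m.+2 hH H0 g01 q1rho zx.
rewrite qm; set y := x + _; move=> kxz.
have dy : eudist x y = rho ^+ m.+1 * eudist x z.
  rewrite (_ : eudist x y = eudist (x + 0 *: (z - x)) y); last by rewrite scale0r addr0.
  by rewrite eudist_line sub0r normrN ger0_norm// exprn_ge0//; lra.
have My : M <= eudist x y by rewrite dy -ler_pdivrMr.
have := hM x y My; rewrite ltr_norml => /andP[_ hy].
have {}hy : eudist x y `^ a * k x y <= 2 * alpha by lra.
apply: (@le_trans _ _ (eudist x z `^ a * ((rho `^ a) ^+ m.+2 * k x y))).
  by rewrite ler_wpM2l// powR_ge0.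
have -> : eudist x z `^ a * ((rho `^ a) ^+ m.+2 * k x y) =
    rho `^ a * (eudist x y `^ a * k x y).
  rewrite dy powRM; [|by rewrite exprn_ge0//; lra|exact: ltW].
  have -> : (rho ^+ m.+1) `^ a = (rho `^ a) ^+ m.+1.
    rewrite -powR_mulrn; last lra.
    by rewrite -powRrM mulrC powRrM powR_mulrn ?powR_ge0.
  by rewrite exprS; ring.
have -> : 2 * rho `^ a * alpha = rho `^ a * (2 * alpha) by ring.
by rewrite ler_wpM2l.
Qed.

Lemma measurable_far x (lambda : R) :
  measurable ([set z | lambda <= eudist x z] : set (Rn R n)).
Proof.
have := @measurable_fun_ler _ _ R setT (cst lambda) (fun z : Rn R n => eudist x z).
move=> /(_ (measurable_cst _)).
move=> /(_ (@measurable_eudist R n _ _ (cst x) id (measurable_cst _) (@measurable_id _ _ _))).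
by move=> /(_ measurableT [set true] I); rewrite setTI.
Qed.

(* The tail of |x - z|^-(n + sigma) is bounded by comparison with K (1 / 2),
   a probability density of the same order at infinity. *)
Lemma kernel_concentration (K : R -> Rn R n -> Rn R n -> R) (gamma sigma : R) :
  0 < gamma < 1 -> 0 < sigma ->
  (forall alpha, 0 < alpha < 1 ->
     [/\ sym_markov_kernel mu (K alpha), classS sigma alpha (K alpha) &
         classH gamma (((1 + gamma) / (1 - gamma)) `^ (n%:R + sigma)) (K alpha)]) ->
  forall lambda : R, 0 < lambda -> exists2 C : R, 0 < C &
    forall alpha, 0 < alpha < 1 -> forall x,
    (\int[mu]_(z in [set z | (lambda <= eudist x z)%R]) (K alpha x z)%:E <= (C * alpha)%:E)%E.
Proof.
move=> g01 s0 hK lambda l0; set a := n%:R + sigma.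
have a0 : 0 < a by rewrite ltr_wpDl.
have h01 : 0 < (1 / 2 : R) < 1 by apply/andP; split; lra.
have [[mk1 k10 _ k11] S1 _] := hK _ h01; set k1 := K (1 / 2) in mk1 k10 k11 S1.
(* The limit is 1/2 for [k1], so beyond M one has |x - z|^a k1(x, z) >= 1/4, that is |x - z|^-a <= 4
   k1(x, z). *)
have [M hM] := S1 (1 / 4) ltac:(lra).
set A := 2 * ((1 + gamma) / (1 - gamma)) `^ a.
have A0 : 0 < A.
  by rewrite mulr_gt0// powR_gt0// divr_gt0//; case/andP: g01 => ? ?; lra.
pose L := (lambda `^ a)^-1.
have L0 : 0 < L by rewrite invr_gt0 powR_gt0.
exists (A * (L * (2 * `|M|) ^+ n + 4)).
  by rewrite mulr_gt0// ltr_wpDl// mulr_ge0 ?(ltW L0)// exprn_ge0// mulr_ge0.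
move=> alpha al01 x; have al0 : 0 < alpha by case/andP: al01.
have [[mk k0 _ _] hS hH] := hK _ al01.
have mkx : measurable_fun setT (K alpha x) by exact: measurable_kernel_section.
have mk1x : measurable_fun setT (k1 x) by exact: measurable_kernel_section.
have mfar := measurable_far x lambda.
have Aal0 : 0 <= A * alpha := mulr_ge0 (ltW A0) (ltW al0).
(* Majorant of the decay bound on the far region: |x - z|^-a is at most L = lambda^-a while |x - z|
   < |M|, and at most 4 k1 beyond. The absolute value covers a negative M. *)
pose g (z : Rn R n) := A * alpha * (L * \1_(cube x `|M|) z + 4 * k1 x z).
have g0 z : 0 <= g z.
  by rewrite mulr_ge0 ?addr_ge0 ?mulr_ge0 ?(ltW A0) ?(ltW al0) ?(ltW L0) ?powR_ge0.
have mg : measurable_fun setT (EFin \o g).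
  apply/measurable_EFinP; apply: measurable_funM => //; apply: measurable_funD.
    by apply: measurable_funM => //; apply: measurable_indic; exact: measurable_cube.
  exact: measurable_funM.
apply: (@le_trans _ _ (\int[mu]_(z in [set z | (lambda <= eudist x z)%R]) (g z)%:E)%E).
  apply: ge0_le_integral.
  - exact: mfar.
  - by move=> z _; rewrite lee_fin.
  - by apply: measurable_funTS; exact/measurable_EFinP.
  - exact: measurable_funTS.
  move=> z /= lz; rewrite lee_fin.
  have d0 : 0 < eudist x z by exact: lt_le_trans lz.
  have zx : (z : 'rV[R]_n) != x by rewrite eq_sym -eudist_gt0.
  have := kernel_decay g01 s0 al0 hS hH zx; rewrite -/a -/A => dec.
  have da0 : 0 < eudist x z `^ a by rewrite powR_gt0.
  have {dec}dec : K alpha x z <= A * alpha * (eudist x z `^ a)^-1.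
    by rewrite ler_pdivlMr// mulrC.
  apply: le_trans dec _; rewrite /g; apply: ler_wpM2l => //.
  have [zM|Mz] := ltP (eudist x z) `|M|.
    rewrite indicE mem_set; last exact: le_lt_trans (norm_le_eudist _ _) zM.
    rewrite mulr1 ler_wpDr// ?mulr_ge0//.
    by rewrite /L lef_pV2 ?posrE ?powR_gt0// ge0_ler_powR ?nnegrE// ltW.
  have := hM x z (le_trans (ler_norm M) Mz).
  rewrite ltr_norml -/k1 -/a => /andP[h _].
  apply: (@le_trans _ _ (4 * k1 x z)); last first.
    by rewrite ler_wpDl// mulr_ge0// ltW.
  rewrite -[leLHS]mul1r ler_pdivrMr// mulrC mulrCA; lra.
apply: (@le_trans _ _ (\int[mu]_z (g z)%:E)%E).
  by apply: ge0_subset_integral => // z _; rewrite lee_fin.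
rewrite /g.
under eq_integral do rewrite EFinM.
have mc : measurable_fun setT (fun z : Rn R n => (L * \1_(cube x `|M|) z)%:E).
  by apply/measurable_EFinP/measurable_funM => //; apply: measurable_indic; exact: measurable_cube.
have mk1' : measurable_fun setT (fun z : Rn R n => (4 * k1 x z)%:E).
  by apply/measurable_EFinP; exact: measurable_funM.
rewrite ge0_integralZl//; last 2 first.
- under eq_fun do rewrite EFinD; exact: emeasurable_funD.
- by move=> z _; rewrite lee_fin addr_ge0// mulr_ge0// ltW.
under eq_integral do rewrite EFinD.
rewrite ge0_integralD//; last 2 first.
- by move=> z _; rewrite lee_fin mulr_ge0// ltW.
- by move=> z _; rewrite lee_fin mulr_ge0.
under eq_integral do rewrite EFinM.
rewrite ge0_integralZl//; last 2 first.
- by apply/measurable_EFinP; apply: measurable_indic; exact: measurable_cube.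
- by rewrite lee_fin ltW.
rewrite integral_indic//; last exact: measurable_cube.
rewrite setIT.
under [X in (_ * (_ + X))%E]eq_integral do rewrite EFinM.
rewrite ge0_integralZl//; last 2 first.
- exact/measurable_EFinP.
- by move=> z _; rewrite lee_fin.
rewrite k11 mule1 [A * _ * alpha]mulrAC [in leRHS]EFinM.
apply: lee_wpmul2l; first by rewrite lee_fin.
rewrite [leRHS]EFinD; apply: leeD => //; rewrite [leRHS]EFinM; apply: lee_wpmul2l.
  by rewrite lee_fin ltW.
exact: mu_cube_le.
Qed.

End kernels.

(** * Almost everywhere convergence *)

Section approximate_identity.
Context {R : realType} {n : nat} (mu : {measure set (Rn R n) -> \bar R}).
Hypothesis leb : is_lebesgue mu.
Hypothesis n_gt0 : (0 < n)%N.
Context (K : R -> Rn R n -> Rn R n -> R) (gamma H : R).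
Hypothesis g01 : 0 < gamma < 1.
Hypothesis H_ge0 : 0 <= H.
Hypothesis markovK : forall alpha, 0 < alpha < 1 -> sym_markov_kernel mu (K alpha).
Hypothesis harnackK : forall alpha, 0 < alpha < 1 -> classH gamma H (K alpha).
Hypothesis concK : forall lambda : R, 0 < lambda -> exists2 C : R, 0 < C &
    forall alpha, 0 < alpha < 1 -> forall x : Rn R n,
    (\int[mu]_(z in [set z | (lambda <= eudist x z)%R]) (K alpha x z)%:E <= (C * alpha)%:E)%E.

Implicit Types f g h : Rn R n -> R.

(** The extended-real inequality also forces [Kop] to be finite for small alpha, which the linearity
    of the integral will require. *)
Definition conv_at (f : Rn R n -> R) (x : Rn R n) :=
  forall e : R, 0 < e -> exists2 delta : R, 0 < delta &
    forall alpha, 0 < alpha < delta -> alpha < 1 ->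
    (`|Kop mu (K alpha) f x - (f x)%:E| <= e%:E)%E.

Lemma conv_at_cvg f x : conv_at f x ->
  (fun alpha => Kop mu (K alpha) f x) @ 0^'+ --> (f x)%:E.
Proof.
move=> cf.
have ev (e : R) : 0 < e -> \forall alpha \near 0^'+,
    (`|Kop mu (K alpha) f x - (f x)%:E| <= e%:E)%E.
  move=> e0; have [d d0 hd] := cf e e0.
  near=> alpha; apply: hd.
    apply/andP; split; near: alpha; first exact: nbhs_right_gt.
    exact: nbhs_right_lt.
  by near: alpha; exact: nbhs_right_lt.
have fin : \forall alpha \near 0^'+, Kop mu (K alpha) f x \is a fin_num.
  near=> alpha.
  have : (`|Kop mu (K alpha) f x - (f x)%:E| <= 1%:E)%E by near: alpha; exact: ev.
  by case: (Kop mu (K alpha) f x).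
apply/fine_cvgP; split => //.
apply/cvgrPdist_le => e e0; near=> alpha.
have : (`|Kop mu (K alpha) f x - (f x)%:E| <= e%:E)%E by near: alpha; exact: ev.
have : Kop mu (K alpha) f x \is a fin_num by near: alpha.
by move=> /fineK <-; rewrite -EFinB abse_EFin lee_fin distrC.
Unshelve. all: by end_near. Qed.

Let measurable_Kf (f : Rn R n -> R) alpha x : 0 < alpha < 1 -> measurable_fun setT f ->
  measurable_fun setT (fun z => K alpha x z * f z).
Proof.
move=> a01 mf; apply: measurable_funM => //.
by case: (markovK a01) => mk _ _ _; exact: (measurable_kernel_section x mk).
Qed.

(** The integral is the difference of those of the positive and negative parts, and is finite only
    if both are. *)
Lemma integrable_Kf (f : Rn R n -> R) alpha x : 0 < alpha < 1 -> measurable_fun setT f ->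
  Kop mu (K alpha) f x \is a fin_num ->
  mu.-integrable setT (EFin \o (fun z => K alpha x z * f z)).
Proof.
move=> a01 mf fin; apply/integrableP; split; first by apply/measurable_EFinP; exact: measurable_Kf.
by rewrite (integral_fin_num_abs mu measurableT (measurable_Kf x a01 mf)).
Qed.

Lemma conv_at_fin f x : conv_at f x -> exists2 delta : R, 0 < delta &
  forall alpha, 0 < alpha < delta -> alpha < 1 -> Kop mu (K alpha) f x \is a fin_num.
Proof.
move=> cf; have [d d0 hd] := cf 1 ltr01; exists d => // alpha ad a1.
by have := hd alpha ad a1; case: (Kop mu (K alpha) f x).
Qed.

Lemma KopD f g alpha x : 0 < alpha < 1 -> measurable_fun setT f -> measurable_fun setT g ->
  Kop mu (K alpha) f x \is a fin_num -> Kop mu (K alpha) g x \is a fin_num ->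
  Kop mu (K alpha) (f \+ g) x = (Kop mu (K alpha) f x + Kop mu (K alpha) g x)%E.
Proof.
move=> a01 mf mg ff fg; rewrite /Kop.
have -> : (\int[mu]_z (K alpha x z * (f \+ g) z)%:E =
    \int[mu]_z ((K alpha x z * f z)%:E + (K alpha x z * g z)%:E))%E.
  by apply: eq_integral => z _; rewrite /= mulrDr EFinD.
by rewrite integralD//; exact: integrable_Kf.
Qed.

Lemma conv_atD f g x : measurable_fun setT f -> measurable_fun setT g ->
  conv_at f x -> conv_at g x -> conv_at (f \+ g) x.
Proof.
move=> mf mg cf cg e e0.
have [d1 d10 h1] := cf (e / 2) ltac:(lra); have [d2 d20 h2] := cg (e / 2) ltac:(lra).
have [d3 d30 h3] := conv_at_fin cf; have [d4 d40 h4] := conv_at_fin cg.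
exists (minr (minr d1 d2) (minr d3 d4)); first by rewrite !lt_min d10 d20 d30 d40.
move=> alpha /andP[a0]; rewrite !lt_min => /andP[/andP[a1 a2] /andP[a3 a4]] a5.
have a01 : 0 < alpha < 1 by rewrite a0.
rewrite KopD//; [|by apply: h3; rewrite ?a0|by apply: h4; rewrite ?a0].
have := h1 alpha; rewrite a0 a1 => /(_ isT a5); have := h2 alpha; rewrite a0 a2 => /(_ isT a5).
have := h3 alpha; rewrite a0 a3 => /(_ isT a5); have := h4 alpha; rewrite a0 a4 => /(_ isT a5).
move=> /fineK <- /fineK <-; rewrite -EFinD -!EFinB !abse_EFin !lee_fin /= => k2 k1.
rewrite opprD addrACA; apply: le_trans (ler_normD _ _) _; lra.
Qed.

Lemma conv_atZ f (c : R) x : measurable_fun setT f ->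
  conv_at f x -> conv_at (fun z => c * f z) x.
Proof.
move=> mf cf e e0; have c0 := normr_ge0 c.
have [d1 d10 h1] := cf (e / (`|c| + 1)) ltac:(apply: divr_gt0 => //; lra).
have [d3 d30 h3] := conv_at_fin cf.
exists (minr d1 d3); first by rewrite lt_min d10.
move=> alpha /andP[a0]; rewrite !lt_min => /andP[a1 a3] a5.
have a01 : 0 < alpha < 1 by rewrite a0.
have := h1 alpha; rewrite a0 a1 => /(_ isT a5); have := h3 alpha; rewrite a0 a3 => /(_ isT a5).
move=> fin; have -> : Kop mu (K alpha) (fun z => c * f z) x = (c%:E * Kop mu (K alpha) f x)%E.
  rewrite /Kop -integralZl//; last exact: (integrable_Kf a01 mf fin).
  by apply: eq_integral => z _; rewrite -EFinM; congr EFin; ring.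
rewrite -(fineK fin) -EFinM -!EFinB !abse_EFin !lee_fin -mulrBr normrM.
rewrite ler_pdivlMr; last lra.
have := normr_ge0 (fine (Kop mu (K alpha) f x) - f x).
set u := normr _; nra.
Qed.

Lemma eq_conv_at f g x : f =1 g -> conv_at f x -> conv_at g x.
Proof. by move=> /funext ->. Qed.

Let HL (f : Rn R n -> R) := HLmax mu (fun z => `|f z|%:E).

(* Weak type (1,1) turns approximation in mean into pointwise convergence. *)
Lemma conv_at_approx (f : Rn R n -> R) (h : nat -> Rn R n -> R) :
  measurable_fun setT f -> (forall m, measurable_fun setT (h m)) ->
  (forall m, \forall x \ae mu, conv_at (h m) x) ->
  (forall e : R, 0 < e -> exists m, (\int[mu]_z `|f z - h m z|%:E <= e%:E)%E) ->
  \forall x \ae mu, conv_at f x.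
Proof.
move=> mf mh ch app.
pose g m z := f z - h m z.
have mg m : measurable_fun setT (g m) by exact: measurable_funB.
have mng m : measurable_fun setT (fun z => `|g m z|%:E).
  by apply/measurable_EFinP; exact: measurableT_comp.
have ng0 m z : (0 <= `|g m z|%:E)%E by rewrite lee_fin.
pose e j : R := j.+1%:R^-1.
have e0 j : 0 < e j by rewrite invr_gt0.
(* The index m may depend on x, so the bad set is the intersection of all [A m]. It weighs no more
   than any one of them, hence at most [c] times the integral of |g m|, with 3^n in [c] from the
   weak type bound and 1 from the Markov inequality. *)
have small j : \forall x \ae mu, exists m, (HL (g m) x <= (e j)%:E)%E /\ `|g m x| <= e j.
  pose A m := [set x | ((e j)%:E < HL (g m) x)%E] `|` [set x | ((e j)%:E <= `|(g m x)%:E|)%E].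
  have mA1 m : measurable [set x | ((e j)%:E < HL (g m) x)%E].
    exact: measurable_HLmax_superlevel.
  have mA2 m : measurable [set x | ((e j)%:E <= `|(g m x)%:E|)%E].
    have := @measurable_lee _ _ R _ measurableT (cst (e j)%:E) (fun z => `|(g m z)%:E|%E).
    by rewrite setTI => /(_ (measurable_cst _) (mng m)).
  have mA m : measurable (A m) by exact: measurableU.
  exists (\bigcap_m A m); split; first exact: bigcapT_measurable.
    apply/eqP; rewrite eq_le measure_ge0 andbT; apply/lee_addgt0Pr => eps eps0; rewrite add0e.
    pose c : R := (3 ^+ n + 1) / e j.
    have c0 : 0 < c by rewrite divr_gt0// ltr_wpDl// exprn_ge0.
    have [m hm] := app (eps / c) ltac:(exact: divr_gt0).
    apply: (@le_trans _ _ (mu (A m))).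
      by apply: le_measure; rewrite ?inE//; [exact: bigcapT_measurable|move=> x; apply].
    apply: le_trans (measureU2 _ _ _) _ => //.
    have I0 : (0 <= \int[mu]_z `|g m z|%:E)%E by exact: integral_ge0.
    apply: (@le_trans _ _ (c%:E * \int[mu]_z `|g m z|%:E)%E); last first.
      apply: (@le_trans _ _ (c%:E * (eps / c)%:E)%E); first by apply: lee_wpmul2l => //; rewrite lee_fin ltW.
      by rewrite -EFinM lee_fin mulrC divfK// gt_eqF.
    rewrite /c mulrDl EFinD ge0_muleDl//; last 2 first.
    + by rewrite lee_fin divr_ge0// ?exprn_ge0// ltW.
    + by rewrite lee_fin divr_ge0// ltW.
    apply: leeD; first exact: HLmax_weak.
    have := @le_integral_abse _ _ R mu setT measurableT (EFin \o g m) (e j).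
    move=> /(_ ltac:(exact/measurable_EFinP) (e0 j)); rewrite setTI => le1.
    by rewrite div1r lee_pdivlMl.
  move=> x /= nx; apply: contrapT => xA; apply: nx.
  have [m mx] : exists m, ~ A m x.
    by apply/existsNP => allA; apply: xA => m _; exact: allA.
  exists m; split.
    by rewrite leNgt; apply/negP => h1; apply: mx; left.
  by rewrite leNgt; apply/negP => h1; apply: mx; right; rewrite /= lee_fin ltW.
have C0 : 0 <= harnack_const n gamma H.
  by apply: harnack_const_ge0 => //; case/andP: g01 => /ltW.
have := ae_foralln small; have := ae_foralln ch.
apply: filterS2 => x ch' small' eps eps0.
(* Three errors: the maximal function bounds the operator on g m by [harnack_const] times e j; the
   convergence of h m and the value |g m x| cost e j each. *)
pose B : R := harnack_const n gamma H + 2.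
have B0 : 0 < B by rewrite /B; lra.
pose j := Num.truncn (B / eps).
have ej : B * e j <= eps.
  rewrite /e ler_pdivrMr// mulrC -ler_pdivrMr//.
  by apply: ltW; exact: truncnS_gt.
have [m [HLm gm]] := small' j.
have [d1 d10 h1] := ch' m (e j) (e0 j).
have [d2 d20 h2] := conv_at_fin (ch' m).
exists (minr d1 d2); first by rewrite lt_min d10.
move=> alpha /andP[a0]; rewrite !lt_min => /andP[a1 a3] a5.
have a01 : 0 < alpha < 1 by rewrite a0.
have := h1 alpha; rewrite a0 a1 => /(_ isT a5); have := h2 alpha; rewrite a0 a3 => /(_ isT a5).
move=> fin; have Kg : (`|Kop mu (K alpha) (g m) x| <= (harnack_const n gamma H * e j)%:E)%E.
  apply: le_trans (abse_Kop_le _ (markovK a01) (mg m)) _.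
  apply: le_trans (integral_markov_le_HLmax leb n_gt0 _ (markovK a01) (harnackK a01) H_ge0 g01 (mng m) (ng0 m)) _.
  by rewrite [leRHS]EFinM; apply: lee_wpmul2l.
have fing : Kop mu (K alpha) (g m) x \is a fin_num.
  by move: Kg; case: (Kop mu (K alpha) (g m) x).
have -> : Kop mu (K alpha) f x = (Kop mu (K alpha) (g m) x + Kop mu (K alpha) (h m) x)%E.
  rewrite -KopD//; congr Kop; apply/funext => z /=; rewrite /g; ring.
move: Kg; rewrite -(fineK fin) -(fineK fing) -EFinD -!EFinB !abse_EFin !lee_fin.
set u := fine _; set v := fine _ => hu hv.
have -> : u + v - f x = u + (v - h m x) - g m x by rewrite /g; ring.
apply: le_trans (ler_normB _ _) _.
have := ler_normD u (v - h m x).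
move: ej; rewrite /B; lra.
Qed.

Lemma integrable_K alpha x : 0 < alpha < 1 ->
  mu.-integrable setT (EFin \o K alpha x).
Proof.
move=> a01; have [mk k0 _ k1] := markovK a01.
apply/integrableP; split.
  by apply/measurable_EFinP; exact: measurable_kernel_section.
under eq_integral do rewrite abse_EFin ger0_norm//.
by rewrite k1 ltry.
Qed.

Lemma Kop_cst alpha x (c : R) : 0 < alpha < 1 -> Kop mu (K alpha) (cst c) x = c%:E.
Proof.
move=> a01; have [_ _ _ k1] := markovK a01.
rewrite /Kop; under eq_integral do rewrite EFinM.
have := @integralZr _ _ R mu setT measurableT (EFin \o K alpha x) (integrable_K x a01) c.
by move=> /= ->; rewrite k1 mul1e.
Qed.

(** As K(x, .) has mass 1, f may be replaced by f - f(x), which vanishes within lambda of x and is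
    at most 2B elsewhere; the error is then at most 2 B C alpha. The [2 * B + 1] in delta covers B =
    0. *)
Lemma conv_at_loc_const f x (B lambda : R) : measurable_fun setT f ->
  (forall z, `|f z| <= B) -> 0 < lambda ->
  (forall z, eudist x z < lambda -> f z = f x) -> conv_at f x.
Proof.
move=> mf fB l0 fx e e0; have [C C0 hC] := concK l0.
have B0 : 0 <= B by exact: le_trans (fB x).
pose g z := f z - f x.
have mg : measurable_fun setT g by exact: measurable_funB.
have gB z : `|g z| <= 2 * B.
  by apply: le_trans (ler_normB _ _) _; have := fB z; have := fB x; lra.
exists (e / ((2 * B + 1) * C)); first by rewrite divr_gt0// mulr_gt0//; lra.
move=> alpha /andP[a0 ae] a1; have a01 : 0 < alpha < 1 by rewrite a0.
have [mk k0 _ k1] := markovK a01.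
have mkx : measurable_fun setT (K alpha x) by exact: measurable_kernel_section.
have mfar := measurable_far x lambda.
set far := [set z | _] in mfar.
have Kg : (`|Kop mu (K alpha) g x| <= e%:E)%E.
  apply: le_trans (abse_Kop_le _ (markovK a01) mg) _.
  apply: (@le_trans _ _ (\int[mu]_z ((2 * B)%:E * ((EFin \o K alpha x) \_ far) z))%E).
    apply: ge0_le_integral.
    - exact: measurableT.
    - by move=> z _; rewrite -EFinM lee_fin mulr_ge0.
    - by apply: emeasurable_funM; apply/measurable_EFinP => //; exact: measurableT_comp.
    - apply: measurable_funeM; apply/(measurable_restrictT _ _).1 => //.
      by apply: measurable_funTS; exact/measurable_EFinP.
    move=> z _; rewrite patchE; case: ifPn => [_|].
      by rewrite -!EFinM lee_fin mulrC ler_wpM2r.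
    move=> /negP zfar; rewrite /g fx ?subrr ?normr0 ?mule0//.
    by rewrite ltNge; apply/negP => h; apply: zfar; rewrite inE.
  rewrite ge0_integralZl//; last 3 first.
  - apply/(measurable_restrictT _ _).1 => //.
    by apply: measurable_funTS; exact/measurable_EFinP.
  - by move=> z _; apply: erestrict_ge0 => y _; rewrite lee_fin.
  - by rewrite lee_fin mulr_ge0.
  rewrite -integral_mkcond.
  apply: (@le_trans _ _ ((2 * B)%:E * (C * alpha)%:E)%E).
    by apply: lee_wpmul2l; [rewrite lee_fin mulr_ge0|exact: hC].
  rewrite -EFinM lee_fin.
  move: ae; rewrite ltr_pdivlMr; last by rewrite mulr_gt0//; lra.
  have : 0 < C * alpha by rewrite mulr_gt0.
  set u := C * alpha => u0; rewrite mulrCA [alpha * C]mulrC -/u; lra.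
have fing : Kop mu (K alpha) g x \is a fin_num by move: Kg; case: (Kop mu (K alpha) g x).
have -> : Kop mu (K alpha) f x = (Kop mu (K alpha) g x + (f x)%:E)%E.
  rewrite -(Kop_cst x (f x) a01) -KopD//; last by rewrite Kop_cst.
  by congr Kop; apply/funext => z; rewrite /g /=; ring.
by rewrite addeK.
Qed.

(** Equivalently, x is not on the boundary of A. The distance is the Euclidean one of [concK]. *)
Definition loc_const (A : set (Rn R n)) (x : Rn R n) :=
  exists2 lambda : R, 0 < lambda & forall z, eudist x z < lambda -> (A z <-> A x).

Lemma conv_at_indic A x : measurable A -> loc_const A x -> conv_at \1_A x.
Proof.
move=> mA [l l0 hl]; apply: (@conv_at_loc_const _ _ 1 l) => //.
  by move=> z; rewrite indicE; case: (_ \in _); rewrite ?normr1 ?normr0.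
by move=> z /hl zx; rewrite !indicE; congr (_%:R); congr nat_of_bool; apply/idP/idP; rewrite !inE => /zx.
Qed.

Lemma loc_constU A B x : loc_const A x -> loc_const B x -> loc_const (A `|` B) x.
Proof.
move=> [l l0 hl] [m m0 hm]; exists (minr l m); first by rewrite lt_min l0.
move=> z; rewrite lt_min => /andP[/hl[zA Az] /hm[zB Bz]].
by split => -[] ?; [left; exact: zA|right; exact: zB|left; exact: Az|right; exact: Bz].
Qed.

Lemma loc_const_cube (c : 'rV[R]_n) r (x : 'rV[R]_n) : `|c - x| <> r -> loc_const (cube c r) x.
Proof.
move=> /eqP cxr; exists (normr (`|c - x| - r)); first by rewrite normr_gt0 subr_eq0.
move=> z xz; have {}xz := le_lt_trans (norm_le_eudist x z) xz.
have h1 := ler_normD (c - x) (x - z); rewrite subrKA in h1.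
have h2 := ler_normB (c - z) (x - z); rewrite opprB subrKA in h2.
rewrite /cube/=; have [lt_r|le_r] := ltP `|c - x| r.
  by split => // _; move: xz; rewrite ltr0_norm ?subr_lt0//; lra.
split => // cz; exfalso; move: xz; rewrite ger0_norm ?subr_ge0//; lra.
Qed.

(** The boundary of a finite union of cubes is covered by finitely many null spheres. Working with
    the union as a set, not with a sum of indicators, allows overlaps. *)
Lemma ae_conv_cubes (I : Type) (s : seq I) (c : I -> 'rV[R]_n) (r : I -> R) :
  \forall x \ae mu, conv_at \1_(\big[setU/set0]_(i <- s) cube (c i) (r i)) x.
Proof.
suff : \forall x \ae mu, loc_const (\big[setU/set0]_(i <- s) cube (c i) (r i)) x.
  apply: filterS => x; apply: conv_at_indic.
  by apply: bigsetU_measurable => i _; exact: measurable_cube.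
elim: s => [|i s ih].
  by apply: nearW => x; rewrite big_nil; exists 1.
have off_sphere : \forall x \ae mu, `|c i - (x : 'rV[R]_n)| <> r i.
  exists [set x | `|c i - x| = r i]; split; [exact: measurable_sphere|exact: mu_sphere|].
  by move=> x /= /contrapT.
rewrite big_cons; apply: filterS2 ih off_sphere => x h1 h2.
by apply: loc_constU => //; exact: loc_const_cube.
Qed.

(** Finite measure makes mu(U \ A k) decrease to 0, so the indicators converge in mean. *)
Lemma ae_conv_bigcup (A : nat -> set (Rn R n)) : (forall k, measurable (A k)) ->
  {homo A : k l / (k <= l)%N >-> (k <= l)%O} -> (mu (\bigcup_k A k) < +oo)%E ->
  (forall k, \forall x \ae mu, conv_at \1_(A k) x) ->
  \forall x \ae mu, conv_at \1_(\bigcup_k A k) x.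
Proof.
move=> mA ndA fin cA; set U := \bigcup_k A k.
have mU : measurable U by exact: bigcupT_measurable.
apply: (@conv_at_approx _ (fun k => \1_(A k))) => //.
move=> e e0.
have mF k : measurable (U `\` A k) by exact: measurableD.
have intE k : (\int[mu]_z `|\1_U z - \1_(A k) z|%:E = mu (U `\` A k))%E.
  transitivity (\int[mu]_z (\1_(U `\` A k) z)%:E)%E; last by rewrite integral_indic// setIT.
  apply: eq_integral => z _; congr EFin; rewrite !indicE in_setD.
  have [zA|zA] := boolP (z \in A k).
    have -> : z \in U by rewrite inE; exists k => //; rewrite inE in zA.
    by rewrite subrr normr0.
  by rewrite subr0 andbT; case: (_ \in _); rewrite ?normr1 ?normr0.
apply: contrapT => /forallNP far.
have cvgF : mu (U `\` A k) @[k --> \oo] --> mu (\bigcap_k (U `\` A k)).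
  apply: nonincreasing_cvg_mu => //.
  - apply: le_lt_trans fin; apply: le_measure; rewrite ?inE//.
  - exact: bigcapT_measurable.
  - by move=> k l kl; rewrite subsetEset; apply: setDS; rewrite -subsetEset; exact: ndA.
have F0 : \bigcap_k (U `\` A k) = set0.
  apply/seteqP; split => // x xF; have [[k _ Akx] _] := xF 0%N I.
  by have [_] := xF k I.
rewrite F0 measure0 in cvgF.
have : (e%:E <= limn (fun k => mu (U `\` A k)))%E.
  apply: lime_ge; first by apply/cvg_ex; eexists; exact: cvgF.
  by apply: nearW => k; rewrite leNgt; apply/negP => /ltW; rewrite -intE; exact: far.
by rewrite (cvg_lim _ cvgF)// lee_fin leNgt e0.
Qed.

Lemma open_bigcup_qcube (W : set 'rV[R]_n) : open W ->
  W = \bigcup_(j in [set j | @qcube R n j `<=` W]) qcube j :> set (Rn R n).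
Proof.
move=> oW; apply/seteqP; split => [x Wx|x [j jW jx]]; last exact: jW.
have /nbhs_ballP[e /= e0 he] : nbhs (x : 'rV[R]_n) W by exact: open_nbhs_nbhs.
have [q xq] := @ratr_row_approx R n x (e / 4) ltac:(lra).
have [s] := @rat_in_itvoo R (e / 4) (e / 2) ltac:(lra).
rewrite in_itv/= => /andP[s4 s2].
exists (q, s) => [y|]; rewrite /qcube /cube/= /qcenter /qradius/=.
  move=> qy; apply: he; rewrite mx_norm_ball /ball_/= -(subrKA (map_mx ratr q)).
  by apply: le_lt_trans (ler_normD _ _) _; lra.
by rewrite distrC; lra.
Qed.

Lemma eq_ae_conv f g : f =1 g -> (\forall x \ae mu, conv_at f x) ->
  \forall x \ae mu, conv_at g x.
Proof. by move=> /funext ->. Qed.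

Lemma ae_convD f g : measurable_fun setT f -> measurable_fun setT g ->
  (\forall x \ae mu, conv_at f x) -> (\forall x \ae mu, conv_at g x) ->
  \forall x \ae mu, conv_at (f \+ g) x.
Proof. by move=> mf mg; apply: filterS2 => x; exact: conv_atD. Qed.

Lemma ae_convZ f (c : R) : measurable_fun setT f ->
  (\forall x \ae mu, conv_at f x) -> \forall x \ae mu, conv_at (fun z => c * f z) x.
Proof. by move=> mf; apply: filterS => x; exact: conv_atZ. Qed.

(** Intersecting with a fixed cube Q keeps all measures finite and makes complements a difference of
    two good indicators. The good sets thus form a Dynkin system, which contains the open sets
    because these are countable unions of rational cubes. *)
Lemma ae_conv_bounded_indic (r : R) (A : set (Rn R n)) : measurable A ->
  \forall x \ae mu, conv_at \1_(A `&` cube 0 r) x.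
Proof.
set Q := cube 0 r; have mQ : measurable Q by exact: measurable_cube.
have fin (B : set (Rn R n)) : measurable B -> B `<=` Q -> (mu B < +oo)%E.
  move=> mB BQ; apply: le_lt_trans (mu_cube_lty leb 0 r).
  by apply: le_measure; rewrite ?inE.
have convQ : \forall x \ae mu, conv_at \1_Q x.
  have := @ae_conv_cubes unit [:: tt] (fun=> 0) (fun=> r).
  by rewrite big_seq1.
move=> mA.
apply: (@dynkin_induction _ (Rn R n) (@open 'rV[R]_n)
  (fun A => \forall x \ae mu, conv_at \1_(A `&` Q) x)) mA => //.
- exact: openI.
- by rewrite setTI.
- move=> U oU.
  have oW : open (U `&` Q : set 'rV[R]_n) by apply: openI => //; exact: open_cube.
  rewrite (open_bigcup_qcube oW) -bigcup_enum_seq.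
  apply: ae_conv_bigcup.
  + by move=> k; apply: bigsetU_measurable => j _; exact: measurable_cube.
  + exact: nondecreasing_enum_seq.
  + rewrite bigcup_enum_seq -(open_bigcup_qcube oW); apply: fin; last exact: subIsetr.
    exact: open_measurable_Rn.
  + by move=> k; exact: ae_conv_cubes.
- move=> B mB cB.
  apply: (@eq_ae_conv (\1_Q \+ (fun z => -1 * \1_(B `&` Q) z))).
    move=> z /=; rewrite !indicE !in_setI in_setC.
    by case: (z \in B); case: (z \in Q); rewrite /= ?mulr0 ?mulr1 ?addr0 ?subrr.
  have mBQ : measurable (B `&` Q) by exact: measurableI.
  apply: ae_convD => //; first by apply: measurable_funM => //; exact: measurable_indic.
  by apply: ae_convZ.
- move=> F mF tF cF.
  pose G k := \big[setU/set0]_(i < k) F i `&` Q.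
  have mbig k : measurable (\big[setU/set0]_(i < k) F i) by exact: bigsetU_measurable.
  have mG k : measurable (G k) by exact: measurableI.
  have GE : \bigcup_k F k `&` Q = \bigcup_k G k.
    rewrite /G -setI_bigcupl; congr (_ `&` _).
    apply/seteqP; split => [x [k _ Fk]|x [k _]].
      exists k.+1 => //; rewrite big_ord_recr/=; by right.
    by rewrite -bigcup_mkord => -[i _ Fi]; exists i.
  rewrite GE; apply: ae_conv_bigcup => //.
  + move=> k l kl; rewrite subsetEset; apply: setSI.
    rewrite -!bigcup_mkord => x [i /= ik Fi]; exists i => //=; exact: leq_trans kl.
  + rewrite -GE; apply: fin; last exact: subIsetr.
    by apply: measurableI => //; exact: bigcupT_measurable.
  + elim=> [|k ih].
      rewrite /G big_ord0 set0I; apply: nearW => x; apply: conv_at_indic => //.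
      by exists 1.
    apply: (@eq_ae_conv (\1_(G k) \+ \1_(F k `&` Q))).
      move=> z; rewrite /G big_ord_recr/= !indicE !in_setI in_setU.
      case: (z \in Q); rewrite ?andbF ?addr0// !andbT.
      have [zF|zF] := boolP (z \in F k); last by rewrite orbF addr0.
      rewrite [_ \in _](_ : _ = false) ?add0r// -bigcup_mkord.
      apply/negbTE/negP; rewrite inE => -[i /= ik Fi].
      rewrite inE in zF; have := tF i k I I; rewrite /nonempty.
      by move=> /(_ (ex_intro _ z (conj Fi zF))) ik'; rewrite ik' ltnn in ik.
    apply: ae_convD; [by []| |exact: ih|exact: cF].
    by apply: measurable_indic; exact: measurableI.
Qed.

Lemma ae_conv_indic (A : set (Rn R n)) : measurable A -> (mu A < +oo)%E ->
  \forall x \ae mu, conv_at \1_A x.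
Proof.
move=> mA finA.
have AE : A = \bigcup_k (A `&` cube 0 k.+1%:R) by rewrite -setI_bigcupr bigcup_cube setIT.
rewrite AE; apply: ae_conv_bigcup.
- by move=> k; apply: measurableI => //; exact: measurable_cube.
- move=> k l kl; rewrite subsetEset; apply: setIS => x; rewrite /cube/= => /lt_le_trans.
  by apply; rewrite ler_nat ltnS.
- by rewrite -AE.
- by move=> k; exact: ae_conv_bounded_indic.
Qed.

Import HBSimple.

Lemma ae_conv_sfun (g : {sfun Rn R n >-> R}) : mu.-integrable setT (EFin \o g) ->
  \forall x \ae mu, conv_at g x.
Proof.
move=> /integrableP[mg ig].
have mpre (y : R) : measurable (g @^-1` [set y]) by exact: measurable_sfunP.
apply: (@eq_ae_conv (fun z => \sum_(y <- finmap.enum_fset (fset_set (range g))) y * \1_(g @^-1` [set y]) z) g).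
  by move=> z; rewrite [in RHS]fimfunE fsbig_finite//=; exact: fimfunP.
have mterm y : measurable_fun setT (fun z => y * \1_(g @^-1` [set y]) z).
  by apply: measurable_funM => //; exact: measurable_indic.
elim: (finmap.enum_fset _) => [|y s ih].
  apply: (@eq_ae_conv (cst 0)); first by move=> z; rewrite big_nil.
  by apply: nearW => x; apply: (@conv_at_loc_const _ _ 0 1) => // z; rewrite normr0.
apply: (@eq_ae_conv ((fun z => y * \1_(g @^-1` [set y]) z) \+
  (fun z => \sum_(y <- s) y * \1_(g @^-1` [set y]) z))).
  by move=> z; rewrite big_cons.
apply: ae_convD => //; first exact: measurable_sum.
(* Only the zero level set can have infinite measure, and its term vanishes. *)
have [->|y0] := eqVneq y 0.
  apply: (@eq_ae_conv (cst 0)); first by move=> z; rewrite mul0r.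
  by apply: nearW => x; apply: (@conv_at_loc_const _ _ 0 1) => // z; rewrite normr0.
apply: ae_convZ; first exact: measurable_indic.
apply: ae_conv_indic => //.
have ny0 : 0 < `|y| by rewrite normr_gt0.
have := le_integral_abse mu measurableT mg ny0; rewrite setTI => le1.
have le2 : (mu (g @^-1` [set y]) <= mu [set x | (`|y|%:E <= `|(EFin \o g) x|)%E])%E.
  apply: le_measure; rewrite ?inE//; last by move=> x /= ->.
  have := @measurable_lee _ _ R _ measurableT (cst `|y|%:E) (fun z => `|(EFin \o g) z|%E).
  rewrite setTI => /(_ (measurable_cst _)); apply.
  exact: measurableT_comp.
apply: le_lt_trans le2 _; move: le1; rewrite -lee_pdivlMl// => /le_lt_trans; apply.
by rewrite lte_mul_pinfty// ?lee_fin ?invr_ge0// ltW.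
Qed.

Lemma ae_conv_integrable f : mu.-integrable setT (EFin \o f) ->
  \forall x \ae mu, conv_at f x.
Proof.
move=> intf; have mf : measurable_fun setT f.
  by move/measurable_int : intf => /measurable_EFinP.
have [g [ig _ cvgg]] := approximation_sfun_integrable measurableT intf.
apply: (@conv_at_approx _ (fun m => g m)) => //.
- by move=> m; exact: ae_conv_sfun.
- move=> e e0; apply: contrapT => /forallNP far.
  have : (e%:E <= limn (fun m => \int[mu]_z `|(f z)%:E - (g m z)%:E|))%E.
    apply: lime_ge; first by apply/cvg_ex; eexists; exact: cvgg.
    by apply: nearW => m; rewrite leNgt; apply/negP => /ltW; exact: far.
  by rewrite (cvg_lim _ cvgg)// lee_fin leNgt e0.
Qed.

(** Around a point of an open cube, the part of f outside the cube vanishes and concentration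
    disposes of it; the part inside is integrable. Countably many cubes reach every point. *)
Lemma ae_conv_bounded f (B : R) : measurable_fun setT f -> (forall z, `|f z| <= B) ->
  \forall x \ae mu, conv_at f x.
Proof.
move=> mf fB; have B0 : 0 <= B by exact: le_trans (fB 0).
have conv_in k : \forall x \ae mu, conv_at (fun z => f z * \1_(cube 0 k.+1%:R) z) x.
  have mQ : measurable (cube (0 : 'rV[R]_n) k.+1%:R) by exact: measurable_cube.
  apply: ae_conv_integrable; apply/integrableP; split.
    by apply/measurable_EFinP; apply: measurable_funM => //; exact: measurable_indic.
  apply: (@le_lt_trans _ _ (\int[mu]_z (B%:E * (\1_(cube 0 k.+1%:R) z)%:E))%E).
    apply: ge0_le_integral => //.
    - apply: measurableT_comp => //; apply/measurable_EFinP; apply: measurable_funM => //; exact: measurable_indic.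
    - by apply: measurable_funeM; apply/measurable_EFinP; exact: measurable_indic.
    - move=> z _; rewrite abse_EFin -EFinM lee_fin normrM [X in _ * X]ger0_norm//.
      exact: ler_wpM2r.
  rewrite ge0_integralZl//; last by apply/measurable_EFinP; exact: measurable_indic.
  rewrite integral_indic// setIT lte_mul_pinfty// ?lee_fin//.
  exact: mu_cube_lty.
have := ae_foralln conv_in; apply: filterS => x hx.
have [k _ kx] : (\bigcup_k cube (0 : 'rV[R]_n) k.+1%:R) x by rewrite bigcup_cube.
have mQ : measurable (cube (0 : 'rV[R]_n) k.+1%:R) by exact: measurable_cube.
apply: (@eq_conv_at ((fun z => f z * \1_(cube 0 k.+1%:R) z) \+
                     (fun z => f z * \1_(~` cube 0 k.+1%:R) z))).
  move=> z /=; rewrite !indicE in_setC; case: (_ \in _); rewrite /= ?mulr1 ?mulr0 ?addr0 ?add0r//.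
have mout : measurable_fun setT (fun z => f z * \1_(~` cube 0 k.+1%:R) z).
  by apply: measurable_funM => //; apply: measurable_indic; exact: measurableC.
apply: conv_atD => //; first by apply: measurable_funM => //; exact: measurable_indic.
have [l l0 hl] : loc_const (cube 0 k.+1%:R) x.
  by apply: loc_const_cube => xk; move: kx; rewrite /cube/= xk ltxx.
apply: (@conv_at_loc_const _ _ B l) => //.
  move=> z; rewrite normrM; apply: le_trans (fB z).
  by rewrite ler_piMr//; rewrite indicE; case: (_ \in _); rewrite ?normr1 ?normr0.
move=> z /hl[_ zQ]; rewrite !indicE !memNset ?mulr0//.
by move/(_ (zQ kx)).
Qed.

(** The hypothesis puts f in L^1 + L^oo by a cut at height B, a form common to all exponents. *)
Lemma ae_conv f (B : R) : measurable_fun setT f -> 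
  (\int[mu]_(z in [set z | (B < `|f z|)%R]) `|f z|%:E < +oo)%E ->
  \forall x \ae mu, conv_at f x.
Proof.
move=> mf intf; set E := [set z | B < `|f z|].
have mnf : measurable_fun setT (fun z => `|f z|) by exact: measurableT_comp.
have mE : measurable E.
  have := @measurable_fun_ltr _ _ R setT (cst B) (fun z => `|f z|) (measurable_cst _) mnf.
  by move=> /(_ measurableT [set true] I); rewrite setTI.
apply: (@eq_ae_conv ((fun z => f z * \1_E z) \+ (fun z => f z * \1_(~` E) z))).
  by move=> z /=; rewrite !indicE in_setC; case: (_ \in _); rewrite /= ?mulr1 ?mulr0 ?addr0 ?add0r.
have m1 : measurable_fun setT (fun z => f z * \1_E z).
  by apply: measurable_funM => //; exact: measurable_indic.
have m2 : measurable_fun setT (fun z => f z * \1_(~` E) z).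
  by apply: measurable_funM => //; apply: measurable_indic; exact: measurableC.
apply: ae_convD => //.
  apply: ae_conv_integrable; apply/integrableP; split; first exact/measurable_EFinP.
  apply: le_lt_trans intf; rewrite [leRHS]integral_mkcond.
  rewrite le_eqVlt; apply/orP; left; apply/eqP; apply: eq_integral => z _.
  rewrite patchE abse_EFin normrM indicE; case: (_ \in _).
    by rewrite normr1 mulr1.
  by rewrite normr0 mulr0.
(* B may be negative, while the cut function takes the value 0 on E. *)
apply: (@ae_conv_bounded _ (maxr B 0)) => //.
move=> z; rewrite normrM indicE in_setC le_max.
have [zE|zE] := boolP (z \in E); first by rewrite /= normr0 mulr0 lexx orbT.
rewrite /= normr1 mulr1; apply/orP; left; rewrite leNgt; apply/negP => h.
by move/negP: zE; apply; rewrite inE.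
Qed.

End approximate_identity.

(** * The maximal operator *)

Section maximal_operator.
Context {R : realType} {n : nat} (mu : {measure set (Rn R n) -> \bar R}).
Hypothesis leb : is_lebesgue mu.
Hypothesis n_gt0 : (0 < n)%N.
Context (K : R -> Rn R n -> Rn R n -> R) (gamma H : R).
Hypothesis g01 : 0 < gamma < 1.
Hypothesis H_ge0 : 0 <= H.
Hypothesis markovK : forall alpha, 0 < alpha < 1 -> sym_markov_kernel mu (K alpha).
Hypothesis harnackK : forall alpha, 0 < alpha < 1 -> classH gamma H (K alpha).
Implicit Types f : Rn R n -> R.

Let C := harnack_const n gamma H.

Let C_ge0 : 0 <= C.
Proof. by apply: harnack_const_ge0 => //; case/andP: g01 => /ltW. Qed.

Lemma Kstar_le_HLmax f x : measurable_fun setT f ->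
  (Kstar mu K f x <= C%:E * HLmax mu (fun z => `|f z|%:E) x)%E.
Proof.
move=> mf; apply: ge_ereal_sup => _ [alpha + <-]; rewrite /= in_itv/= => a01.
apply: le_trans (abse_Kop_le _ (markovK a01) mf) _.
apply: (integral_markov_le_HLmax leb n_gt0 _ (markovK a01) (harnackK a01) H_ge0 g01).
  by apply/measurable_EFinP; exact: measurableT_comp.
by move=> z; rewrite lee_fin.
Qed.

(** The measurable superset is a superlevel set of the maximal function. Using C + 1 in place of C
    makes it safe to divide by it. *)
Lemma Kstar_weak11 f (t : R) : measurable_fun setT f -> 0 < t ->
  exists2 A : set (Rn R n), measurable A /\ [set x | (t%:E < Kstar mu K f x)%E] `<=` A &
    (mu A <= ((C + 1) * 3 ^+ n / t)%:E * Lnorm mu 1%E (EFin \o f))%E.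
Proof.
move=> mf t0; pose F z := `|f z|%:E.
have mF : measurable_fun setT F by apply/measurable_EFinP; exact: measurableT_comp.
have F0 z : (0 <= F z)%E by rewrite lee_fin.
have C1 : 0 < C + 1 by rewrite ltr_wpDl.
have tC : 0 < t / (C + 1) by rewrite divr_gt0.
exists [set x | ((t / (C + 1))%:E < HLmax mu F x)%E].
  split; first exact: measurable_HLmax_superlevel.
  move=> x /= tx; rewrite ltNge; apply/negP => le_t.
  move: tx; rewrite ltNge => /negP; apply.
  apply: le_trans (Kstar_le_HLmax x mf) _.
  apply: (@le_trans _ _ (C%:E * (t / (C + 1))%:E)%E); first by apply: lee_wpmul2l.
  rewrite -EFinM lee_fin mulrCA ler_piMr ?(ltW t0)// ler_pdivrMr//; lra.
apply: le_trans (HLmax_weak leb mF F0 tC) _.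
rewrite Lnorm1; apply: lee_wpmul2r; first exact: integral_ge0.
rewrite lee_fin le_eqVlt; apply/orP; left; apply/eqP.
by field; rewrite !gt_eqF.
Qed.

(** Stated for the measurable majorant of [Kstar]. The constant is C times the p-th root of the
    interpolation constant for B = 2 * 3^n, the factor in [HLmax_weak_trunc]. *)
Lemma Kstar_strong (p : R) : 1 < p -> exists C' : R, forall f, measurable_fun setT f ->
  (Lnorm mu p%:E (fun x => C%:E * HLmax mu (fun z => `|f z|%:E) x) <=
   C'%:E * Lnorm mu p%:E (EFin \o f))%E.
Proof.
move=> p1; have p0 : 0 < p by lra.
pose D := marcinkiewicz_const (2 * 3 ^+ n) p.
have B0 : 0 <= 2 * 3 ^+ n :> R by rewrite mulr_ge0// exprn_ge0.
have D0 : 0 <= D by exact: marcinkiewicz_const_ge0.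
exists (C * D `^ p^-1) => f mf; pose F z := `|f z|%:E.
have mF : measurable_fun setT F by apply/measurable_EFinP; exact: measurableT_comp.
have F0 z : (0 <= F z)%E by rewrite lee_fin.
have M0 x : (0 <= HLmax mu F x)%E by exact: HLmax_ge0.
have mM : measurable_fun setT (HLmax mu F) by exact: measurable_HLmax.
have mnf : measurable_fun setT (fun z => `|f z|) by exact: measurableT_comp.
have := @marcinkiewicz _ _ R mu (HLmax mu F) (fun z => `|f z|) (2 * 3 ^+ n) p
  mM M0 mnf (fun z => normr_ge0 _) B0 p1
  (fun t t0 => HLmax_weak_trunc leb mF F0 t0).
rewrite -/D => strong.
rewrite unlock.
have -> : (\int[mu]_x (`|C%:E * HLmax mu F x| `^ p) =
    (C `^ p)%:E * \int[mu]_x (HLmax mu F x `^ p))%E.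
  rewrite -ge0_integralZl//.
  - by apply: eq_integral => x _; rewrite gee0_abs ?mule_ge0// poweRM// poweR_EFin.
  - exact: (measurableT_comp (measurable_poweR p)).
  - by move=> x _; exact: poweR_ge0.
  - by rewrite lee_fin powR_ge0.
have -> : (\int[mu]_x (`|(EFin \o f) x| `^ p) = \int[mu]_x (`|f x| `^ p)%:E)%E.
  by apply: eq_integral.
have I0 : (0 <= \int[mu]_x (`|f x| `^ p)%:E)%E.
  by apply: integral_ge0 => x _; rewrite lee_fin powR_ge0.
have -> : ((C * D `^ p^-1)%:E * (\int[mu]_x (`|f x| `^ p)%:E) `^ p^-1 =
    ((C `^ p)%:E * (D%:E * \int[mu]_x (`|f x| `^ p)%:E)) `^ p^-1)%E.
  rewrite poweRM ?lee_fin ?powR_ge0// ?mule_ge0// poweRM// !poweR_EFin -powRrM.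
  by rewrite divff ?gt_eqF// powRr1// muleA EFinM.
apply: gt0_ler_poweR; rewrite ?invr_ge0 ?(ltW p0)//.
- rewrite in_itv/= leey andbT mule_ge0 ?lee_fin ?powR_ge0//.
  by apply: integral_ge0 => x _; exact: poweR_ge0.
- by rewrite in_itv/= leey andbT mule_ge0 ?lee_fin ?powR_ge0// mule_ge0.
- by apply: lee_wpmul2l => //; rewrite lee_fin powR_ge0.
Qed.

(** [Lnorm] at [+oo] unfolds to an essential supremum only under this positivity test. *)
Lemma lebesgue_setT_gt0 : (0 < mu [set: Rn R n])%E.
Proof.
apply: lt_le_trans (_ : (1 <= mu setT)%E); first exact: lte01.
have := mu_cube_ge leb 0 (@ltr01 R); rewrite expr1n => /le_trans; apply.
by apply: le_measure; rewrite ?inE//; exact: measurable_cube.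
Qed.

(** The bound holds at every x: K(x, z) dz is absolutely continuous, so an almost everywhere bound
    on f can be integrated against it. *)
Lemma Kstar_le_esssup f x : measurable_fun setT f ->
  (Kstar mu K f x <= Lnorm mu +oo%E (EFin \o f))%E.
Proof.
move=> mf; apply: ge_ereal_sup => _ [alpha + <-]; rewrite /= in_itv/= => a01.
have [mk k0 _ k1] := markovK a01.
have mkx : measurable_fun setT (K alpha x) by exact: measurable_kernel_section.
apply: le_trans (abse_Kop_le _ (markovK a01) mf) _.
set L := Lnorm _ _ _.
have L0 : (0 <= L)%E by exact: Lnorm_ge0.
have Lae : \forall z \ae mu, (`|f z|%:E <= L)%E.
  by rewrite /L unlock lebesgue_setT_gt0; exact: (ess_sup_ge mu (abse \o (EFin \o f))).
apply: (@le_trans _ _ (\int[mu]_z (L * (K alpha x z)%:E))%E).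
  apply: ae_ge0_le_integral => //.
  - by move=> z _; rewrite -EFinM lee_fin mulr_ge0.
  - by apply: emeasurable_funM; apply/measurable_EFinP => //; exact: measurableT_comp.
  - by move=> z _; rewrite mule_ge0// lee_fin.
  - by apply: measurable_funeM; exact/measurable_EFinP.
  apply: filterS Lae => z fL _; rewrite muleC; apply: lee_wpmul2r => //.
  by rewrite lee_fin.
rewrite ge0_integralZl//; first by rewrite k1 mule1.
- exact/measurable_EFinP.
- by move=> z _; rewrite lee_fin.
Qed.

End maximal_operator.

(** For finite p take B = 1, since |f| <= |f|^p where |f| > 1; for p = oo take the norm of f, above
    which |f| lies only on a null set. *)
Lemma inLp_tail_integrable (R : realType) (n : nat) (mu : {measure set (Rn R n) -> \bar R})
    (p : \bar R) (f : Rn R n -> R) : is_lebesgue mu -> (1 <= p)%E -> inLp mu p f ->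
  exists B : R, (\int[mu]_(z in [set z | (B < `|f z|)%R]) `|f z|%:E < +oo)%E.
Proof.
move=> leb p1 [mf fp].
have mnf : measurable_fun setT (fun z => `|f z|) by exact: measurableT_comp.
have mE (B : R) : measurable [set z | B < `|f z|].
  have := @measurable_fun_ltr _ _ R setT (cst B) (fun z => `|f z|) (measurable_cst _) mnf.
  by move=> /(_ measurableT [set true] I); rewrite setTI.
move: p p1 fp => [p| |]//.
- rewrite lee_fin => p1 fp; exists 1.
  have p0 : 0 < p by lra.
  have fpp : (\int[mu]_z (`|f z| `^ p)%:E < +oo)%E.
    have : (Lnorm mu p%:E (EFin \o f) `^ p < +oo)%E.
      by rewrite ltey; apply/eqP => /poweR_eqy h; rewrite h in fp.
    by rewrite poweR_Lnorm ?gt_eqF.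
  have mfp : measurable_fun setT (fun z => (`|f z| `^ p)%:E).
    by apply/measurable_EFinP; exact: (measurableT_comp (measurable_powR p)).
  apply: le_lt_trans fpp.
  apply: (@le_trans _ _ (\int[mu]_(z in [set z | (1 < `|f z|)%R]) (`|f z| `^ p)%:E)%E).
    apply: ge0_le_integral => //.
    - by apply: measurable_funTS; exact/measurable_EFinP.
    - exact: measurable_funTS.
    - by move=> z /= f1; rewrite lee_fin le1r_powR// ltW.
  by apply: ge0_subset_integral => // z _; rewrite lee_fin powR_ge0.
- move=> _ fy; set L := Lnorm _ _ _ in fy.
  have L0 : (0 <= L)%E by exact: Lnorm_ge0.
  have finL : L \is a fin_num by rewrite ge0_fin_numE.
  exists (fine L); rewrite (_ : (\int[mu]_(z in _) _)%E = 0%E)//.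
  apply: null_set_integral => //.
    by apply: measurable_funTS; exact/measurable_EFinP.
  have : \forall z \ae mu, (`|f z|%:E <= L)%E.
    by rewrite /L unlock lebesgue_setT_gt0//; exact: (ess_sup_ge mu (abse \o (EFin \o f))).
  move=> [N [mN N0 subN]]; apply: (subset_measure0 _ mN) => //.
  move=> z /= Lf; apply: subN => /=; rewrite -(fineK finL) lee_fin.
  by apply/negP; rewrite -ltNge.
Qed.

Theorem theorem3p3 (R : realType) (n : nat) (mu : {measure set (Rn R n) -> \bar R})
  (sigma gamma : R) (K : R -> Rn R n -> Rn R n -> R) :
  (1 <= n)%N -> is_lebesgue mu -> 0 < sigma -> 0 < gamma < 1 ->
  (forall alpha, 0 < alpha < 1 ->
     [/\ sym_markov_kernel mu (K alpha),
         classS sigma alpha (K alpha) &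
         classH gamma (((1 + gamma) / (1 - gamma)) `^ (n%:R + sigma)) (K alpha)]) ->
  [/\
  (* (a) concentration property *)
    (forall lambda : R, 0 < lambda -> forall e : R, 0 < e ->
       exists2 delta : R, 0 < delta & forall alpha, 0 < alpha < delta -> alpha < 1 ->
         forall x : Rn R n,
           (\int[mu]_(z in [set z | (lambda <= eudist x z)%R]) (K alpha x z)%:E
              <= e%:E)%E),
  (* (b1) weak type (1,1) *)
    (exists C : R, forall f, inLp mu 1%E f -> forall t : R, 0 < t ->
       exists2 A : set (Rn R n), measurable A /\
           [set x | (t%:E < Kstar mu K f x)%E] `<=` A &
         (mu A <= (C / t)%:E * Lnorm mu 1%E (EFin \o f))%E),
  (* (b2) bounded on L^p, 1 < p <= oo *)
    (forall p : \bar R, (1 < p)%E -> exists C : R, forall f, inLp mu p f ->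
       exists2 g : Rn R n -> \bar R, measurable_fun setT g /\
           (forall x, (Kstar mu K f x <= g x)%E) &
         (Lnorm mu p g <= C%:E * Lnorm mu p (EFin \o f))%E) &
  (* (c) a.e. convergence *)
    (forall (p : \bar R) (f : Rn R n -> R), (1 <= p)%E -> inLp mu p f ->
       {ae mu, forall x, (fun alpha => Kop mu (K alpha) f x) @ 0^'+ --> (f x)%:E})].
Proof.
move=> n0 leb s0 g01 hK.
set H := ((1 + gamma) / (1 - gamma)) `^ (n%:R + sigma) in hK *.
have H0 : 0 <= H by exact: powR_ge0.
have markovK alpha : 0 < alpha < 1 -> sym_markov_kernel mu (K alpha) by move=> /hK[].
have harnackK alpha : 0 < alpha < 1 -> classH gamma H (K alpha) by move=> /hK[].
have conc := kernel_concentration leb g01 s0 hK.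
split.
- move=> lambda l0 e e0; have [C C0 hC] := conc _ l0.
  exists (e / C); first by rewrite divr_gt0.
  move=> alpha /andP[a0 ae] a1 x; apply: le_trans (hC alpha _ x) _; first by rewrite a0.
  by rewrite lee_fin mulrC -ler_pdivlMr// ltW.
- exists ((harnack_const n gamma H + 1) * 3 ^+ n) => f [mf _] t t0.
  exact: (Kstar_weak11 leb n0 g01 H0 markovK harnackK).
- move=> [p| |]//.
    rewrite lte_fin => p1.
    have [C hC] := Kstar_strong leb g01 H0 p1.
    exists C => f [mf _].
    exists (fun x => (harnack_const n gamma H)%:E * HLmax mu (fun z => `|f z|%:E) x)%E.
      split; first by apply: measurable_funeM; exact: measurable_HLmax.
      by move=> x; exact: (Kstar_le_HLmax leb n0 g01 H0 markovK harnackK).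
    exact: hC.
  move=> _; exists 1 => f [mf _]; rewrite mul1e.
  exists (cst (Lnorm mu +oo%E (EFin \o f))).
    by split; [exact: measurable_cst|move=> x; exact: (Kstar_le_esssup leb markovK)].
  have := Lnorm_ge0 mu +oo%E (EFin \o f).
  move: (Lnorm mu +oo%E (EFin \o f)) => L L0.
  rewrite unlock lebesgue_setT_gt0//.
  by apply/ess_supP; apply: nearW => x /=; rewrite gee0_abs.
- move=> p f p1 fp; have [B fB] := inLp_tail_integrable leb p1 fp.
  have := ae_conv leb n0 g01 H0 markovK harnackK conc fp.1 fB.
  by apply: filterS => x; exact: conv_at_cvg.
Qed.
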